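(* $H^1(\mathbb B)=H^2(\mathbb B)\star H^2(\mathbb B)+H^2(\mathbb B)\star H^2(\mathbb B)$; that is, a regular function $f$ on $\mathbb B$ belongs to $H^1(\mathbb B)$ if and only if there exist $f_1,g_1,f_2,g_2\in H^2(\mathbb B)$ with $f=f_1\star g_1+f_2\star g_2$.
   Context: $\mathbb H$ is the skew-field of quaternions, $\mathbb B=\{q\in\mathbb H:|q|<1\}$, $\mathbb S=\{q\in\mathbb H:q^2=-1\}$. Regular functions on $\mathbb B$ are the functions $f(q)=\sum_{n\ge0}q^na_n$, $a_n\in\mathbb H$, with power series converging in $\mathbb B$. The $\star$-product of $f=\sum q^na_n$ and $g=\sum q^nb_n$ is $f\star g(q)=\sum_{n\ge0}q^n\sum_{k=0}^na_kb_{n-k}$. $H^2(\mathbb B)$ is the space of regular $f=\sum q^na_n$ with $\sum|a_n|^2<\infty$. $H^1(\mathbb B)$ is the space of regular $f$ with $\sup_{I\in\mathbb S}\sup_{0<r<1}\frac1{2\pi}\int_{-\pi}^{\pi}|f(re^{I\theta})|d\theta<\infty$. $H^2(\mathbb B)\star H^2(\mathbb B)$ denotes the set $\{f\star g: f,g\in H^2(\mathbb B)\}$. *)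

(* Defs.v *)
From HB Require Import structures.
From mathcomp Require Import all_boot all_order all_algebra.
From mathcomp Require Import ring lra.
From mathcomp Require Import all_classical all_reals all_analysis.

Set Implicit Arguments.
Unset Strict Implicit.
Unset Printing Implicit Defensive.

Import Order.TTheory GRing.Theory Num.Theory.
Import numFieldNormedType.Exports.

Local Open Scope classical_set_scope.
Local Open Scope ring_scope.

(* [Quat a b c d] is a + b i + c j + d k. *)
Record quat (R : Type) := Quat { qre : R; qi : R; qj : R; qk : R }.

Section QuaternionAlgebra.
Variable R : realType.
Implicit Types (p q : quat R) (x : R).

Definition quat_tuple q := (qre q, qi q, qj q, qk q).
Definition tuple_quat (t : R * R * R * R) :=
  let: (a, b, c, d) := t in Quat a b c d.

Lemma quat_tupleK : cancel quat_tuple tuple_quat.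
Proof. by case. Qed.

HB.instance Definition _ := Choice.copy (quat R) (can_type quat_tupleK).

Definition quat_add p q :=
  Quat (qre p + qre q) (qi p + qi q) (qj p + qj q) (qk p + qk q).

Definition quat_opp q := Quat (- qre q) (- qi q) (- qj q) (- qk q).

Definition quat_mul p q := Quat
  (qre p * qre q - qi p * qi q - qj p * qj q - qk p * qk q)
  (qre p * qi q + qi p * qre q + qj p * qk q - qk p * qj q)
  (qre p * qj q - qi p * qk q + qj p * qre q + qk p * qi q)
  (qre p * qk q + qi p * qj q - qj p * qi q + qk p * qre q).

Definition quat_scale x q := Quat (x * qre q) (x * qi q) (x * qj q) (x * qk q).

Definition quat_norm q :=
  Num.sqrt (qre q ^+ 2 + qi q ^+ 2 + qj q ^+ 2 + qk q ^+ 2).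

Fact quat_addA : associative quat_add.
Proof. by move=> [? ? ? ?] [? ? ? ?] [? ? ? ?]; congr Quat => /=; ring. Qed.

Fact quat_addC : commutative quat_add.
Proof. by move=> [? ? ? ?] [? ? ? ?]; congr Quat => /=; ring. Qed.

Fact quat_add0 : left_id (Quat 0 0 0 0) quat_add.
Proof. by move=> [? ? ? ?]; congr Quat => /=; ring. Qed.

Fact quat_addN : left_inverse (Quat 0 0 0 0) quat_opp quat_add.
Proof. by move=> [? ? ? ?]; congr Quat => /=; ring. Qed.

HB.instance Definition _ :=
  GRing.isZmodule.Build (quat R) quat_addA quat_addC quat_add0 quat_addN.

Fact quat_mulA : associative quat_mul.
Proof. by move=> [? ? ? ?] [? ? ? ?] [? ? ? ?]; congr Quat => /=; ring. Qed.

Fact quat_mul1 : left_id (Quat 1 0 0 0) quat_mul.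
Proof. by move=> [? ? ? ?]; congr Quat => /=; ring. Qed.

Fact quat_mulr1 : right_id (Quat 1 0 0 0) quat_mul.
Proof. by move=> [? ? ? ?]; congr Quat => /=; ring. Qed.

Fact quat_mulDl : left_distributive quat_mul +%R.
Proof. by move=> [? ? ? ?] [? ? ? ?] [? ? ? ?]; congr Quat => /=; ring. Qed.

Fact quat_mulDr : right_distributive quat_mul +%R.
Proof. by move=> [? ? ? ?] [? ? ? ?] [? ? ? ?]; congr Quat => /=; ring. Qed.

Fact quat_oner_neq0 : Quat 1 0 0 0 != 0 :> quat R.
Proof. by apply/eqP => -[] /eqP; rewrite oner_eq0. Qed.

HB.instance Definition _ := GRing.Zmodule_isNzRing.Build (quat R)
  quat_mulA quat_mul1 quat_mulr1 quat_mulDl quat_mulDr quat_oner_neq0.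

Fact quat_scaleA x y q :
  quat_scale x (quat_scale y q) = quat_scale (x * y) q.
Proof. by congr Quat => /=; ring. Qed.

Fact quat_scale1 : left_id 1 quat_scale.
Proof. by move=> [? ? ? ?]; congr Quat => /=; ring. Qed.

Fact quat_scaleDr : right_distributive quat_scale +%R.
Proof. by move=> ? [? ? ? ?] [? ? ? ?]; congr Quat => /=; ring. Qed.

Fact quat_scaleDl q : {morph quat_scale^~ q : x y / x + y}.
Proof. by move=> ? ?; congr Quat => /=; ring. Qed.

HB.instance Definition _ := GRing.Zmodule_isLmodule.Build R (quat R)
  quat_scaleA quat_scale1 quat_scaleDr quat_scaleDl.

Fact quat_scaleAl x p q : x *: (p * q) = (x *: p) * q.
Proof. by congr Quat => /=; ring. Qed.

HB.instance Definition _ :=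
  GRing.Lmodule_isLalgebra.Build R (quat R) quat_scaleAl.

Fact quat_scaleAr x p q : x *: (p * q) = p * (x *: q).
Proof. by congr Quat => /=; ring. Qed.

HB.instance Definition _ :=
  GRing.Lalgebra_isAlgebra.Build R (quat R) quat_scaleAr.

Fact quat_normD p q : quat_norm (p + q) <= quat_norm p + quat_norm q.
Proof.
case: p q => [a b c d] [a' b' c' d']; rewrite /quat_norm /=.
set X := a ^+ 2 + _ + _ + _; set Y := a' ^+ 2 + _ + _ + _.
have X0 : 0 <= X by rewrite !addr_ge0 ?sqr_ge0.
have Y0 : 0 <= Y by rewrite !addr_ge0 ?sqr_ge0.
rewrite -[leRHS]ger0_norm ?addr_ge0 ?sqrtr_ge0// -sqrtr_sqr ler_sqrt ?sqr_ge0//.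
rewrite [leRHS]sqrrD !sqr_sqrtr// -sqrtrM//.
have XYE : X * Y = (a * a' + b * b' + c * c' + d * d') ^+ 2 +
    ((a * b' - b * a') ^+ 2 + (a * c' - c * a') ^+ 2 +
     (a * d' - d * a') ^+ 2 + (b * c' - c * b') ^+ 2 +
     (b * d' - d * b') ^+ 2 + (c * d' - d * c') ^+ 2).
  by rewrite /X /Y; ring.
have : a * a' + b * b' + c * c' + d * d' <= Num.sqrt (X * Y).
  rewrite (le_trans (ler_norm _))// -sqrtr_sqr ler_wsqrtr//.
  by rewrite XYE lerDl !addr_ge0 ?sqr_ge0.
by rewrite /X /Y; nra.
Qed.

Fact quat_normZ x q : quat_norm (x *: q) = `|x| * quat_norm q.
Proof.
rewrite /quat_norm -sqrtr_sqr -sqrtrM ?sqr_ge0//; congr Num.sqrt => /=; ring.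
Qed.

Fact quat_norm_eq0 q : quat_norm q = 0 -> q = 0.
Proof.
case: q => a b c d /eqP; rewrite sqrtr_eq0 /= => h.
have [a0 b0 c0 d0] : [/\ a = 0, b = 0, c = 0 & d = 0].
  by split; apply/eqP; rewrite -sqrf_eq0; apply/eqP; nra.
by rewrite a0 b0 c0 d0.
Qed.

(* Convergence of quaternionic series refers to the topology of this norm. *)
HB.instance Definition _ := Lmodule_isNormed.Build R (quat R)
  quat_normD quat_normZ quat_norm_eq0.

End QuaternionAlgebra.

Section RegularFunctions.
Variable R : realType.
Notation H := (quat R).
Implicit Types (f g : H -> H) (a b : nat -> H).

Definition unit_ball : set H := [set q | `|q| < 1].

Definition imaginary_units : set H := [set q | q ^+ 2 = -1].

(* Functions on the unit ball are represented by total functions whose values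
   outside [unit_ball] are irrelevant. *)
Definition expansion f a :=
  forall q, unit_ball q -> series (fun n => q ^+ n * a n) @ \oo --> f q.

Definition regular : set (H -> H) := [set f | exists a, expansion f a].

(* The coefficients of a regular function are unique; a function which is not
   regular gets the zero sequence. *)
Definition coefs f : nat -> H := xget (fun=> 0) (expansion f).

Definition star f g : H -> H := fun q =>
  limn (series (fun n =>
    q ^+ n * \sum_(k < n.+1) coefs f k * coefs g (n - k)%N)).

Definition hardy2 : set (H -> H) := [set f |
  regular f /\ (\sum_(0 <= n <oo) (`|coefs f n| ^+ 2)%:E < +oo)%E].

(* e^{I t} = cos t + I sin t for I an imaginary unit *)
Definition slice_exp (I : H) (t : R) : H := (cos t)%:A + sin t *: I.

Definition circle_mean f (I : H) (r : R) : \bar R :=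
  (((2 * pi)^-1)%:E *
   \int[lebesgue_measure]_(t in `[(- pi)%R, pi]) (`|f (r *: slice_exp I t)|)%:E)%E.

Definition hardy1 : set (H -> H) := [set f |
  regular f /\
  (ereal_sup [set ereal_sup [set circle_mean f I r | r in `]0%R, 1%R[]
             | I in imaginary_units] < +oo)%E].

End RegularFunctions.

(* Main.v *)
(* The easy inclusion: on a slice through the unit I, split A(q) into its parts
   commuting and anticommuting with I; then A * B (q) = A1(q) B(q) + A2(q) B(q'),
   with q' the conjugate of q, so AM-GM and Parseval bound the L1 means by the
   l2 norms of the coefficients.

   The converse: fix i, j and write f(z) = F(z) + G(z) j on the slice of i, with
   F and G complex. If F = F1 F2 and G = G1 G2 with F1, F2, G1, G2 in the complex
   H^2, then f = F1 * F2 + G1 * (G2 j), so the point is the Riesz factorization of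
   complex H^1 functions. By weak compactness (a limit of the coefficients along
   an ultrafilter) it is enough to factor a polynomial P approximately, with
   control of the l2 norms by the L1 mean of |P| on the circle. Reflecting the
   roots of P lying in the disc gives a polynomial Q with |Q| = |P| on the
   circle and, modulo X^N, P = B Q with B a truncated Blaschke product, which
   contracts partial l2 norms. Every linear factor 1 - b X with |b| <= 1, hence
     Q, is
   an l1-limit of squares S^2 of polynomials, by truncating the binomial series;
   then P is close to (B S) S, and |S|^2 is close to |P| on the circle. *)
From HB Require Import structures.
From mathcomp Require Import all_boot all_order all_algebra.
From mathcomp Require Import ring lra.
From mathcomp Require Import all_classical all_reals all_analysis.
From mathcomp Require Import measurable_realfun complex.
Require Import Defs.

Set Implicit Arguments.
Unset Strict Implicit.
Unset Printing Implicit Defensive.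

Import Order.TTheory GRing.Theory Num.Theory.
Import numFieldNormedType.Exports.

Local Open Scope classical_set_scope.
Local Open Scope ring_scope.

(** * Polynomials with the l1 norm of coefficients *)

Section PolyL1.
Context {C : numClosedFieldType}.
Implicit Types (p q : {poly C}) (a b z : C).

(** Submultiplicative, and dominates both the sup norm on the closed unit disc and the l2 norm of
    the coefficients, so a single error bound serves for values on the circle and for
    coefficients. *)
Definition l1norm p : C := \sum_(i < size p) `|p`_i|.

Lemma l1normE n p : (size p <= n)%N -> l1norm p = \sum_(i < n) `|p`_i|.
Proof.
move=> le_pn; rewrite /l1norm (big_ord_widen _ (fun i => `|p`_i|) le_pn).
rewrite big_mkcond; apply: eq_bigr => i _.
by case: ltnP => // le_pi; rewrite nth_default ?normr0.
Qed.

Lemma l1norm_ge0 p : 0 <= l1norm p.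
Proof. exact: sumr_ge0. Qed.

Lemma l1normD p q : l1norm (p + q) <= l1norm p + l1norm q.
Proof.
set n := maxn (size p) (size q).
rewrite (@l1normE n) ?size_polyD// (@l1normE n p) ?leq_maxl//.
rewrite (@l1normE n q) ?leq_maxr// -big_split ler_sum// => i _.
by rewrite coefD ler_normD.
Qed.

Lemma l1norm0 : l1norm 0 = 0.
Proof. by rewrite /l1norm size_poly0 big_ord0. Qed.

Lemma l1normZ a p : l1norm (a *: p) = `|a| * l1norm p.
Proof.
rewrite (l1normE (size_scale_leq a p)) mulr_sumr.
by apply: eq_bigr => i _; rewrite coefZ normrM.
Qed.

Lemma l1norm_MXaddC p a : l1norm (p * 'X + a%:P) = l1norm p + `|a|.
Proof.
rewrite (@l1normE (size p).+1); last first.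
  rewrite (leq_trans (size_polyD _ _))// geq_max.
  by rewrite (leq_trans (size_polyMleq _ _)) ?size_polyX ?addn2//= (leq_trans
    (size_polyC_leq1 _)).
rewrite big_ord_recl addrC; congr (_ + _).
  by apply: eq_bigr => i _; rewrite coefD coefMX coefC /= addr0.
by rewrite coefD coefMX coefC /= add0r.
Qed.

(** Induction on [p] in Horner form: multiplication by ['X] only shifts the coefficients and so
    keeps the norm. *)
Lemma l1normM p q : l1norm (p * q) <= l1norm p * l1norm q.
Proof.
elim/poly_ind: p => [|p a IHp]; first by rewrite mul0r l1norm0 mul0r.
rewrite mulrDl l1norm_MXaddC mulrDl -mulrA ['X * q]mulrC mulrA mul_polyC.
rewrite (le_trans (l1normD _ _))// l1normZ lerD2r.
by have := l1norm_MXaddC (p * q) 0; rewrite addr0 normr0 addr0 => ->.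
Qed.

Lemma norm_horner_le_l1norm p z : `|z| <= 1 -> `|p.[z]| <= l1norm p.
Proof.
move=> z1; rewrite horner_coef (le_trans (ler_norm_sum _ _ _))// ler_sum// => i _.
by rewrite normrM normrX ler_piMr// exprn_ile1.
Qed.

Lemma sum_sqr_coef_le_l1norm n p : \sum_(i < n) `|p`_i| ^+ 2 <= l1norm p ^+ 2.
Proof.
set m := maxn n (size p).
have le_ip (i : 'I_m) : `|p`_i| <= l1norm p.
  rewrite (@l1normE m) ?leq_maxr// (bigD1 i)//= lerDl sumr_ge0//.
apply: (@le_trans _ _ (\sum_(i < m) `|p`_i| ^+ 2)).
  rewrite (big_ord_widen m (fun i => `|p`_i| ^+ 2)) ?leq_maxl//.
  by rewrite big_mkcond ler_sum// => i _; case: ifP => // _; rewrite exprn_ge0.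
rewrite [X in _ <= X]expr2 [X in _ <= X * _](@l1normE m) ?leq_maxr// mulr_suml.
by apply: ler_sum => i _; rewrite expr2 ler_wpM2l.
Qed.

Lemma comp_polyZX_coef p b n : (p \Po (b *: 'X))`_n = b ^+ n * p`_n.
Proof.
rewrite comp_polyE coef_sum (bigID (fun i : 'I__ => i == n :> nat))/=.
rewrite [X in _ + X]big1 ?addr0; last first.
  by move=> i /negPf ni; rewrite exprZn !coefZ coefXn eq_sym ni !mulr0.
have [n_p|p_n] := ltnP n (size p); last first.
  rewrite nth_default// mulr0 big1// => i /eqP e.
  by move: (ltn_ord i); rewrite e ltnNge p_n.
rewrite (big_pred1 (Ordinal n_p)); last by move=> i; rewrite -[RHS]val_eqE.
by rewrite exprZn !coefZ coefXn eqxx mulr1 mulrC.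
Qed.

Lemma l1norm_comp_polyZX p b : `|b| <= 1 -> l1norm (p \Po (b *: 'X)) <= l1norm p.
Proof.
move=> b1; rewrite (@l1normE (size p)); last first.
  by apply/leq_sizeP => j pj; rewrite comp_polyZX_coef nth_default ?mulr0.
apply: ler_sum => i _; rewrite comp_polyZX_coef normrM normrX.
by rewrite ler_piMl// exprn_ile1.
Qed.

End PolyL1.

(* The coefficients of (1 - X)^(-1/2) and (1 - X)^(1/2). *)
Section SqrtSeries.
Context {F : numFieldType}.

Fixpoint invsqrt_coef n : F :=
  if n is m.+1 then invsqrt_coef m * m.*2.+1%:R / m.*2.+2%:R else 1.

Definition sqrt_coef n : F :=
  if n is m.+1 then - invsqrt_coef m / m.*2.+2%:R else 1.

Lemma invsqrt_coef_ge0 n : 0 <= invsqrt_coef n.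
Proof. by elim: n => //= n IHn; rewrite !mulr_ge0 ?invr_ge0. Qed.

Lemma sqrt_coef_le0 n : (0 < n)%N -> sqrt_coef n <= 0.
Proof. by case: n => //= n _; rewrite mulNr oppr_le0 divr_ge0 ?invsqrt_coef_ge0.
  Qed.

(** Dividing a power series by 1 - X takes partial sums of its coefficients, and (1 - X)^(1/2) / (1
    - X) = (1 - X)^(-1/2). *)
Lemma sum_sqrt_coef n : \sum_(k < n.+1) sqrt_coef k = invsqrt_coef n.
Proof.
elim: n => [|n IHn]; first by rewrite big_ord1.
rewrite big_ord_recr/= IHn.
rewrite -[n.*2.+2]addn1 natrD.
have : n.*2.+1%:R + 1 != 0 :> F by rewrite natr1 pnatr_eq0.
by move: n.*2.+1%:R (invsqrt_coef n) => x y x0; field.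
Qed.

(** The equation 2 (1 - X) D' = - D for D = (1 - X)^(1/2), read off at degree [n]. *)
Lemma sqrt_coefS n : n.+1%:R * sqrt_coef n.+1 = (n%:R - 2^-1) * sqrt_coef n.
Proof.
have nz k : k.+1%:R != 0 :> F by rewrite pnatr_eq0.
case: n => [|n] /=; first by rewrite mul1r mulr1 sub0r mulN1r.
have [x1 x2] : n%:R + 1 != 0 :> F /\ n%:R + 2 != 0 :> F.
  by rewrite natr1 -natrD addn2 !nz.
have -> : n.*2.+1%:R = 2 * n%:R + 1 :> F by rewrite -natrM natr1 mul2n.
have -> : n.*2.+2%:R = 2 * (n%:R + 1) :> F.
  by rewrite natr1 -natrM mul2n doubleS.
have -> : n.*2.+4%:R = 2 * (n%:R + 2) :> F.
  by rewrite -natrD addn2 -natrM mul2n !doubleS.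
have -> : n.+2%:R = n%:R + 2 :> F by rewrite -natrD addn2.
have -> : n.+1%:R = n%:R + 1 :> F by rewrite natr1.
by move: (n%:R : F) (invsqrt_coef n) x1 x2 => x y x1 x2; field; apply/andP.
Qed.

(* The recurrence for the coefficients [e] of the square D^2 comes from
   2 (1 - X) D' = - D. *)
Lemma sqrt_coef_conv n :
  \sum_(k < n.+1) sqrt_coef k * sqrt_coef (n - k) = (n == 0)%:R - (n == 1)%:R.
Proof.
pose e n := \sum_(k < n.+1) sqrt_coef k * sqrt_coef (n - k).
(* Split m as k + (m - k) under the sum; reversing the index shows that the two halves are equal. *)
have sym m : m%:R * e m = 2 * \sum_(k < m.+1) k%:R * sqrt_coef k * sqrt_coef (m
  - k).
  have -> : m%:R * e m = \sum_(k < m.+1) (k%:R * sqrt_coef k * sqrt_coef (m - k))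
     + \sum_(k < m.+1) ((m - k)%:R * sqrt_coef k * sqrt_coef (m - k)).
    rewrite -big_split mulr_sumr; apply: eq_bigr => k _ /=.
    have km : (k <= m)%N by rewrite -ltnS.
    by rewrite -{1}(subnKC km) natrD mulrDl !mulrA.
  rewrite [X in _ + X](reindex_inj rev_ord_inj)/= mulr_natl mulr2n; congr (_ + _).
  apply: eq_bigr => k _; have km : (k <= m)%N by rewrite -ltnS.
  by rewrite subSS (subKn km) mulrAC.
have rec m : m.+1%:R * e m.+1 = (m%:R - 1) * e m.
  rewrite sym big_ord_recl/= !mul0r add0r mulrBl sym mul1r.
  transitivity (2 * \sum_(k < m.+1) (k%:R - 2^-1) * sqrt_coef k * sqrt_coef (m -
    k)).
    congr (_ * _); apply: eq_bigr => k _ /=.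
    by rewrite /bump /= add1n subSS sqrt_coefS.
  have -> : e m = 2 * \sum_(k < m.+1) 2^-1 * sqrt_coef k * sqrt_coef (m - k).
    under eq_bigr do rewrite -mulrA.
    by rewrite -mulr_sumr mulrA mulfV ?mul1r ?pnatr_eq0.
  rewrite -mulrBr -sumrB; congr (_ * _).
  by apply: eq_bigr => k _; rewrite -!mulrBl.
have e0 : e 0 = 1 by rewrite /e big_ord1 mulr1.
have e1 : e 1 = -1 by have := rec 0; rewrite e0 mul1r sub0r mulr1.
rewrite -/(e n); case: n => [|[|n]]; rewrite ?e0 ?e1 ?subr0 ?sub0r//=.
elim: n => [|n IHn].
  by apply: (@mulfI _ 2); rewrite ?pnatr_eq0// rec subrr mul0r mulr0.
by apply: (@mulfI _ n.+3%:R); rewrite ?pnatr_eq0// rec IHn !mulr0.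
Qed.

Lemma invsqrt_coef_sqr_le n : invsqrt_coef n ^+ 2 <= n.+1%:R^-1.
Proof.
(* This sharper bound is inductive: passing to n + 1 multiplies the left side by
   (2n+1)(2n+3)/(2n+2)^2 <= 1. *)
suff h : invsqrt_coef n ^+ 2 * n.*2.+1%:R <= 1.
  rewrite -[leRHS]mul1r ler_pdivlMr ?ltr0Sn//.
  apply: le_trans h; rewrite ler_wpM2l ?sqr_ge0 ?exprn_ge0 ?invsqrt_coef_ge0//.
  by rewrite ler_nat ltnS -addnn leq_addr.
elim: n => [|n IHn]; first by rewrite expr1n mulr1.
apply: le_trans IHn.
rewrite /= -mulrA exprMn -mulrA ler_wpM2l ?exprn_ge0 ?invsqrt_coef_ge0//.
rewrite expr_div_n mulrAC ler_pdivrMr ?exprn_gt0 ?ltr0Sn//.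
rewrite -!natrX -!natrM ler_nat doubleS; move: n.*2.+1 => x.
have -> : (x * x.+1 ^ 2 = x ^ 2 * x.+2 + x)%N by rewrite -[x.+2]addn2
  -[x.+1]addn1; ring.
by rewrite leq_addr.
Qed.

End SqrtSeries.

(** * Near-squares, truncated Blaschke products and approximate factorization of polynomials *)

Section Factorization.
Context {C : numClosedFieldType}.
Implicit Types (P Q S T B p q : {poly C}) (a b c e z : C) (N : nat).

(* The error has nonnegative coefficients, so its l1 norm is its value at 1. *)
Lemma l1norm_sqrt_trunc N :
  l1norm ((\poly_(k < N.+1) sqrt_coef k) ^+ 2 - (1 - 'X) : {poly C})
    = invsqrt_coef N ^+ 2.
Proof.
set D : {poly C} := \poly_(k < N.+1) _; set E := _ - _.
have E_ge0 n : 0 <= E`_n.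
  rewrite !coefB coef1 coefX expr2 coefM.
  (* Up to degree [N] truncation is invisible and the coefficient vanishes. Above it, a surviving
     term never involves the constant coefficient, so it is a product of two nonpositive numbers. *)
  have [nN|Nn] := leqP n N.
    rewrite -sqrt_coef_conv subr_ge0 le_eqVlt; apply/orP; left; apply/eqP.
    apply: eq_bigr => k _; rewrite !coef_poly !ltnS.
    by rewrite (leq_trans (leq_subr _ _) nN) (leq_trans _ nN)// -ltnS.
  rewrite -[n == 0]negbK -lt0n (leq_ltn_trans _ Nn)//= sub0r opprK addr_ge0//.
  apply: sumr_ge0 => k _; rewrite !coef_poly !ltnS.
  case: ifP => [kN|_]; last by rewrite mul0r.
  case: ifP => [nkN|_]; last by rewrite mulr0.
  rewrite mulr_le0 ?sqrt_coef_le0// ?subn_gt0 ?(leq_ltn_trans kN)// lt0n.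
  by apply: contraTneq nkN => ->; rewrite subn0 -ltnNge.
have -> : l1norm E = E.[1].
  rewrite horner_coef; apply: eq_bigr => i _.
  by rewrite expr1n mulr1 ger0_norm.
rewrite /E !hornerE subrr subr0 horner_poly -sum_sqrt_coef; congr (_ ^+ 2).
by apply: eq_bigr => i _; rewrite expr1n mulr1.
Qed.

(** The exact square root is in general only a power series; approximate polynomial squares keep the
    argument inside [{poly C}]. *)
Definition near_square Q : Prop :=
  forall e, 0 < e -> exists S, l1norm (S ^+ 2 - Q) <= e.

Lemma near_squareC c : near_square c%:P.
Proof.
move=> e e0; exists (sqrtC c)%:P.
by rewrite -polyC_exp sqrtCK subrr l1norm0 ltW.
Qed.

Lemma near_squareM P Q : near_square P -> near_square Q -> near_square (P * Q).
Proof.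
move=> sqP sqQ e e0.
have [|S hS] := sqP (e / 2 / (1 + l1norm Q)).
  by rewrite !divr_gt0// ltr_wpDr ?l1norm_ge0.
(* [T] is chosen after [S], since its tolerance depends on the norm of [S ^+ 2]; the added 1 keeps
   the denominators positive. *)
have [|T hT] := sqQ (e / 2 / (1 + l1norm (S ^+ 2))).
  by rewrite !divr_gt0// ltr_wpDr ?l1norm_ge0.
exists (S * T).
have -> : (S * T) ^+ 2 - P * Q = S ^+ 2 * (T ^+ 2 - Q) + (S ^+ 2 - P) * Q by ring.
rewrite (le_trans (l1normD _ _))// [leRHS](splitr e) lerD//.
  rewrite (le_trans (l1normM _ _))// (le_trans (ler_wpM2l _ hT)) ?l1norm_ge0//.
  rewrite mulrCA ler_piMr ?divr_ge0 ?(ltW e0)//.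
  by rewrite ltW// ltr_pdivrMr ?mul1r ?ltrDr// ltr_wpDr ?l1norm_ge0.
rewrite (le_trans (l1normM _ _))// (le_trans (ler_wpM2r _ hS)) ?l1norm_ge0//.
rewrite -[leLHS]mulrA ler_piMr ?divr_ge0 ?(ltW e0)//.
by rewrite mulrC ltW// ltr_pdivrMr ?mul1r ?ltrDr// ltr_wpDr ?l1norm_ge0.
Qed.

(** A closed numeric field may fail to be archimedean; this makes the truncation error 1/(n+1) of
    the square root smaller than any tolerance. *)
Hypothesis archiC : forall e, 0 < e -> exists n, n.+1%:R^-1 <= e.

(** Substituting [b *: 'X] for ['X] does not increase the l1 norm, so the truncated root of 1 - X
    serves for every [b] in the closed disc. *)
Lemma near_square_linear b : `|b| <= 1 -> near_square (1 - b *: 'X).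
Proof.
move=> b1 e e0; have [n ne] := archiC e0.
pose D : {poly C} := \poly_(k < n.+1) sqrt_coef k.
exists (D \Po (b *: 'X)).
have -> : (D \Po (b *: 'X)) ^+ 2 - (1 - b *: 'X) = (D ^+ 2 - (1 - 'X)) \Po (b *:
  'X).
  by rewrite !rmorphB rmorphXn rmorph1/= comp_polyX.
rewrite (le_trans (l1norm_comp_polyZX _ b1))// l1norm_sqrt_trunc.
by rewrite (le_trans (invsqrt_coef_sqr_le _)).
Qed.

(** Multiplication by a Blaschke product contracts H^2. Only the first [N] coefficients are compared
    because [B] stands for a truncation at that order. *)
Definition contraction N B : Prop :=
  forall p, \sum_(i < N) `|(B * p)`_i| ^+ 2 <= \sum_(i < N) `|p`_i| ^+ 2.

Lemma contractionM N A B : contraction N A -> contraction N B -> contraction N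
  (A * B).
Proof. by move=> cA cB p; rewrite -mulrA (le_trans (cA _)). Qed.

(* Truncation at degree [N] of the power series of [1 / (1 - conj a X)]. *)
Definition geom N a : {poly C} := \sum_(k < N) (a^* *: 'X) ^+ k.

Lemma geomE N a : (1 - a^* *: 'X) * geom N a = 1 - (a^* ^+ N) *: 'X^N.
Proof. by rewrite -opprB mulNr -subrX1 exprZn opprB. Qed.

(* Multiplication by a Blaschke factor: with u the coefficients of
   X * geom N a * p one has p_n = u_(n+1) - conj a u_n and
   (product)_n = u_n - a u_(n+1), and
   |x - conj a y|^2 - |y - a x|^2 = (1 - |a|^2) (|x|^2 - |y|^2) telescopes. *)
Lemma contraction_blaschke N a :
  `|a| <= 1 -> contraction N (('X - a%:P) * geom N a).
Proof.
move=> a1 p; pose w := geom N a * p; pose u := 'X * w.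
have vE n : (('X - a%:P) * geom N a * p)`_n = u`_n - a * u`_n.+1.
  by rewrite -mulrA -/w mulrBl coefB coefCM /u [in u`__.+1]coefXM.
have pE n : (n < N)%N -> p`_n = u`_n.+1 - a^* * u`_n.
  move=> nN; have -> : p = (1 - a^* *: 'X) * w + (a^* ^+ N *: ('X^N * p)).
    by rewrite /w mulrA geomE mulrBl mul1r scalerAl subrK.
  rewrite coefD coefZ coefXnM nN mulr0 addr0 mulrBl mul1r coefB -scalerAl coefZ.
  by rewrite /u [in RHS]coefXM.
have id x y : `|x - a^* * y| ^+ 2 =
    `|y - a * x| ^+ 2 + (1 - `|a| ^+ 2) * (`|x| ^+ 2 - `|y| ^+ 2).
  by rewrite !normCK !rmorphB !rmorphM/= conjCK; ring.
suff h m : (m <= N)%N -> \sum_(i < m) `|p`_i| ^+ 2 =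
    \sum_(i < m) `|(('X - a%:P) * geom N a * p)`_i| ^+ 2
      + (1 - `|a| ^+ 2) * `|u`_m| ^+ 2.
  rewrite h// lerDl mulr_ge0 ?exprn_ge0// subr_ge0.
  by rewrite exprn_ile1.
elim: m => [|m IHm] mN.
  by rewrite !big_ord0 coefXM/= normr0 expr0n mulr0 addr0.
rewrite !big_ord_recr/= IHm 1?ltnW// pE// id vE.
ring.
Qed.

Lemma inner_outer N (rs : seq C) : exists Q B R,
  [/\ near_square Q, contraction N B,
      forall z, `|z| = 1 -> `|Q.[z]| = `|(\prod_(a <- rs) ('X - a%:P)).[z]| &
      B * Q = \prod_(a <- rs) ('X - a%:P) + R * 'X^N].
Proof.
elim: rs => [|a rs [Q [B [R [sqQ cB nQ BQ]]]]].
  exists 1, 1, 0; split => [|p|z _|]; first exact: near_squareC.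
  - by rewrite mul1r.
  - by rewrite big_nil.
  - by rewrite big_nil mulr1 mul0r addr0.
rewrite big_cons; have [a1|a1] := boolP (`|a| <= 1).
  (* Root in the closed disc: its reflection goes to the outer factor and a truncated Blaschke
     factor to the inner one. The truncation error of [geom] is a multiple of ['X^N]. *)
  exists ((1 - a^* *: 'X) * Q), (('X - a%:P) * geom N a * B).
  exists (('X - a%:P) * (R - a^* ^+ N *: (B * Q))); split.
  - by apply: near_squareM => //; apply: near_square_linear; rewrite norm_conjC.
  - exact/contractionM/cB/contraction_blaschke.
  - move=> z z1; rewrite !hornerM !normrM nQ//; congr (_ * _).
    rewrite !hornerE.
    (* On the circle, |1 - conj(a) z| = |z| |1 - a conj(z)| = |z - a|, by z conj(z) = 1. *)
    transitivity (`|z| * `|(1 - a^* * z)^*|); first by rewrite z1 mul1r norm_conjC.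
    rewrite -normrM rmorphB rmorphM rmorph1/= conjCK mulrBr mulr1.
    by rewrite mulrCA -normCK z1 expr1n mulr1.
  - have := geomE N a; set g := geom N a; set L := 1 - _ => Lg.
    transitivity (('X - a%:P) * (L * g) * (B * Q)); first by ring.
    by rewrite Lg {1}BQ -mul_polyC -[in RHS]mul_polyC BQ; ring.
(* Root outside the disc: X - a = - a (1 - X / a) is itself a near-square and stays in the outer
   factor. *)
exists (('X - a%:P) * Q), B, (('X - a%:P) * R); split => //.
- have a_gt1 : 1 < `|a| by rewrite real_ltNge ?real1.
  have a0 : a != 0 by rewrite -normr_gt0 (lt_trans _ a_gt1).
  have -> : 'X - a%:P = (- a)%:P * (1 - a^-1 *: 'X).
    by rewrite mulrBr mulr1 mul_polyC scalerA mulNr mulfV// scaleN1r opprK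
      polyCN addrC.
  apply: near_squareM => //; apply: near_squareM; first exact: near_squareC.
  by apply: near_square_linear; rewrite normfV invf_le1 ?ltW// (lt_trans _ a_gt1).
- by move=> z z1; rewrite !hornerM !normrM nQ.
- by rewrite mulrCA BQ; ring.
Qed.

(** With T = B S and c the leading coefficient, T S = B (S^2 - c Q) + P modulo X^N. The contraction
    property of [B] bounds both the l2 norm of [T] and the coefficients of the error. *)
Lemma near_factorization P N e : 0 < e -> exists Q S T,
  [/\ forall z, `|z| = 1 -> `|Q.[z]| = `|P.[z]|, l1norm (S ^+ 2 - Q) <= e,
      \sum_(i < N) `|T`_i| ^+ 2 <= \sum_(i < N) `|S`_i| ^+ 2 &
      forall n, (n < N)%N -> `|(T * S)`_n - P`_n| <= e].
Proof.
move=> e0; have [rs defP] := closed_field_poly_normal P; set c := lead_coef P in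
  defP.
have [Q [B [R [sqQ cB nQ BQ]]]] := inner_outer N rs.
have [S hS] := near_squareM (near_squareC c) sqQ e0.
exists (c%:P * Q), S, (B * S); split => // [z z1|n nN].
  by rewrite defP hornerM hornerC hornerZ !normrM nQ.
have -> : B * S * S = B * (S ^+ 2 - c%:P * Q) + P + c *: R * 'X^N.
  rewrite {1}defP -!mul_polyC.
  transitivity (B * (S ^+ 2 - c%:P * Q) + c%:P * (B * Q)); first by ring.
  by rewrite BQ; ring.
rewrite !coefD coefMXn nN addr0 addrK.
set D := S ^+ 2 - _ in hS *.
rewrite -(@ler_pXn2r _ 2) ?nnegrE ?(ltW e0)//.
apply: (@le_trans _ _ (\sum_(i < N) `|(B * D)`_i| ^+ 2)).
  rewrite (bigD1 (Ordinal nN))//= lerDl; apply: sumr_ge0 => i _.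
  exact: exprn_ge0.
rewrite (le_trans (cB D))// (le_trans (sum_sqr_coef_le_l1norm _ _))//.
by rewrite ler_pXn2r ?nnegrE ?l1norm_ge0 ?(ltW e0).
Qed.

End Factorization.

(** * Quaternions *)

Section Quaternions.
Context {R : realType}.
Notation H := (quat R).
Implicit Types (p q : H) (x y r t : R).

Definition quat_dot p q : R :=
  qre p * qre q + qi p * qi q + qj p * qj q + qk p * qk q.

Lemma normq_sqr q : `|q| ^+ 2 = quat_dot q q.
Proof.
rewrite [`|q|]/(quat_norm q) sqr_sqrtr; last by rewrite !addr_ge0 ?sqr_ge0.
by rewrite !expr2.
Qed.

Lemma normqM p q : `|p * q| = `|p| * `|q|.
Proof.
apply: (@pexpIrn _ 2) => //; rewrite ?nnegrE ?mulr_ge0//.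
rewrite exprMn !normq_sqr; case: p q => [a b c d] [a' b' c' d'].
rewrite /quat_dot /=; ring.
Qed.

Lemma normq1 : `|1 : H| = 1.
Proof.
apply: (@pexpIrn _ 2) => //; rewrite ?nnegrE// normq_sqr /quat_dot /=; ring.
Qed.

Lemma normqX q n : `|q ^+ n| = `|q| ^+ n.
Proof. by elim: n => [|n IHn]; rewrite ?normq1// !exprS normqM IHn. Qed.

Lemma qreD : {morph @qre R : p q / p + q}. Proof. by []. Qed.
Lemma qiD : {morph @qi R : p q / p + q}. Proof. by []. Qed.
Lemma qjD : {morph @qj R : p q / p + q}. Proof. by []. Qed.
Lemma qkD : {morph @qk R : p q / p + q}. Proof. by []. Qed.

Lemma quat_dotDl q : {morph quat_dot^~ q : p p' / p + p'}.
Proof. by move=> p p'; rewrite /quat_dot qreD qiD qjD qkD; ring. Qed.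

Lemma quat_dot0 q : quat_dot 0 q = 0.
Proof. by rewrite /quat_dot /= !mul0r !addr0. Qed.

Lemma quat_dot_suml (I : Type) (s : seq I) (P : pred I) (F : I -> H) q :
  quat_dot (\sum_(i <- s | P i) F i) q = \sum_(i <- s | P i) quat_dot (F i) q.
Proof. exact: (big_morph _ (quat_dotDl q) (quat_dot0 q)). Qed.

Lemma normq_sqrD p q : `|p + q| ^+ 2 = `|p| ^+ 2 + 2 * quat_dot p q + `|q| ^+ 2.
Proof. by rewrite !normq_sqr /quat_dot qreD qiD qjD qkD; ring. Qed.

Lemma quat_eqP p q :
  p = q <-> [/\ qre p = qre q, qi p = qi q, qj p = qj q & qk p = qk q].
Proof. by case: p q => [a b c d] [a' b' c' d']; split => [[-> -> -> ->]|[/= ->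
  -> -> ->]]. Qed.

Lemma qre_le_norm q : `|qre q| <= `|q|.
Proof.
rewrite -(@ler_pXn2r _ 2) ?nnegrE// real_normK ?num_real// normq_sqr /quat_dot; nra.
Qed.
Lemma qi_le_norm q : `|qi q| <= `|q|.
Proof.
rewrite -(@ler_pXn2r _ 2) ?nnegrE// real_normK ?num_real// normq_sqr /quat_dot; nra.
Qed.
Lemma qj_le_norm q : `|qj q| <= `|q|.
Proof.
rewrite -(@ler_pXn2r _ 2) ?nnegrE// real_normK ?num_real// normq_sqr /quat_dot; nra.
Qed.
Lemma qk_le_norm q : `|qk q| <= `|q|.
Proof.
rewrite -(@ler_pXn2r _ 2) ?nnegrE// real_normK ?num_real// normq_sqr /quat_dot; nra.
Qed.

Lemma norm_le_coords q : `|q| <= `|qre q| + `|qi q| + `|qj q| + `|qk q|.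
Proof.
rewrite -(@ler_pXn2r _ 2) ?nnegrE ?addr_ge0// normq_sqr /quat_dot -!expr2.
rewrite -[qre q ^+ 2]real_normK ?num_real// -[qi q ^+ 2]real_normK ?num_real//.
rewrite -[qj q ^+ 2]real_normK ?num_real// -[qk q ^+ 2]real_normK ?num_real//.
move: (normr_ge0 (qre q)) (normr_ge0 (qi q)) (normr_ge0 (qj q)) (normr_ge0 (qk q)).
set a := `|_|; set b := `|_|; set c := `|_|; set d := `|_| => a0 b0 c0 d0.
rewrite !sqrrD -subr_ge0.
have -> : a ^+ 2 + a * b *+ 2 + b ^+ 2 + (a + b) * c *+ 2 + c ^+ 2
  + (a + b + c) * d *+ 2 + d ^+ 2 - (a ^+ 2 + b ^+ 2 + c ^+ 2 + d ^+ 2) =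
  a * b *+ 2 + (a + b) * c *+ 2 + (a + b + c) * d *+ 2 by ring.
by rewrite !addr_ge0 ?mulrn_wge0 ?mulr_ge0 ?addr_ge0.
Qed.

Lemma imaginary_unitP (I : H) : imaginary_units I <->
  qre I = 0 /\ qi I ^+ 2 + qj I ^+ 2 + qk I ^+ 2 = 1.
Proof.
rewrite /imaginary_units /= expr2; case: I => a b c d.
split => [/quat_eqP /= [h1 h2 h3 h4]|/= [-> h]].
  (* If [a] were nonzero, the vanishing of 2ab, 2ac and 2ad would kill the imaginary part and leave
     a^2 = -1. *)
  have a0 : a = 0.
    apply/eqP; apply/negPn/negP => a0.
    have inj z : a * z + z * a = 0 -> z = 0.
      by move=> /eqP; rewrite mulrC -mulr2n mulrn_eq0/= mulf_eq0 (negPf a0) orbF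
        => /eqP.
    have b0 : b = 0 by apply: inj; lra.
    have c0 : c = 0 by apply: inj; lra.
    have d0 : d = 0 by apply: inj; lra.
    by move: h1; rewrite b0 c0 d0; nra.
  by split=> //; move: h1; rewrite a0; nra.
by apply/quat_eqP; split => /=; [nra|ring|ring|ring].
Qed.

Lemma normq_imaginary_unit (I : H) : imaginary_units I -> `|I| = 1.
Proof.
move=> /imaginary_unitP[h1 h2]; apply: (@pexpIrn _ 2) => //; rewrite ?nnegrE//.
by rewrite normq_sqr /quat_dot h1; nra.
Qed.

(** * The slice through an imaginary unit *)

Section Slice.
Variable (I : H).
Hypothesis hI : imaginary_units I.

Lemma imaginary_unit_sqr : I * I = -1.
Proof. by rewrite -expr2. Qed.

Lemma normq_slice_exp t : `|slice_exp I t| = 1.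
Proof.
have [h1 h2] := (imaginary_unitP I).1 hI.
apply: (@pexpIrn _ 2) => //; rewrite ?nnegrE//.
rewrite normq_sqr /quat_dot /= h1 expr1n.
transitivity (cos t ^+ 2 + sin t ^+ 2 * (qi I ^+ 2 + qj I ^+ 2 + qk I ^+ 2)).
  by ring.
by rewrite h2 mulr1 cos2Dsin2.
Qed.

Lemma slice_expD x y : slice_exp I x * slice_exp I y = slice_exp I (x + y).
Proof.
have [h1 h2] := (imaginary_unitP I).1 hI.
rewrite /slice_exp sinD cosD.
have {h1 h2} : exists b c d, I = Quat 0 b c d /\ b ^+ 2 + c ^+ 2 + d ^+ 2 = 1.
  by exists (qi I), (qj I), (qk I); split=> //; apply/quat_eqP.
move=> [b [c [d [-> h]]]]; apply/quat_eqP; split => /=; try ring.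
transitivity (cos x * cos y - (b ^+ 2 + c ^+ 2 + d ^+ 2) * (sin x * sin y)).
  by ring.
by rewrite h; ring.
Qed.

Lemma slice_exp0 : slice_exp I 0 = 1.
Proof. by rewrite /slice_exp cos0 sin0 scale1r scale0r addr0. Qed.

Lemma slice_expX t n : slice_exp I t ^+ n = slice_exp I (n%:R * t).
Proof.
elim: n => [|n IHn]; first by rewrite mul0r slice_exp0.
by rewrite exprS IHn slice_expD -[in RHS]natr1 mulrDl mul1r addrC.
Qed.

(** Left multiplication by the unit quaternion e^{Ix} is an isometry, so the left side is the
    product of [p] with e^{I(y-x)} [q]. This yields the orthogonality of distinct frequencies. *)
Lemma quat_dot_slice_exp x y p q :
  quat_dot (slice_exp I x * p) (slice_exp I y * q) =
  cos (y - x) * quat_dot p q + sin (y - x) * quat_dot p (I * q).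
Proof.
have [h1 h2] := (imaginary_unitP I).1 hI.
rewrite cosB sinB /slice_exp.
have {h1 h2} : exists b c d, I = Quat 0 b c d /\ b ^+ 2 + c ^+ 2 + d ^+ 2 = 1.
  by exists (qi I), (qj I), (qk I); split=> //; apply/quat_eqP.
move=> [b [c [d [-> h]]]]; case: p q => [p0 p1 p2 p3] [q0 q1 q2 q3].
rewrite /quat_dot /=.
move: (cos x) (sin x) (cos y) (sin y) => cx sx cy sy.
(* The two sides differ by a multiple of |I|^2 - 1; [k] is its cofactor. *)
pose k := sx * sy * (p0 * q0 + p1 * q1 + p2 * q2 + p3 * q3).
apply/eqP; rewrite -subr_eq0; apply/eqP.
transitivity ((b ^+ 2 + c ^+ 2 + d ^+ 2 - 1) * k); first by rewrite /k; ring.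
by rewrite h subrr mul0r.
Qed.

(* Writing [A] as a part commuting with [I] plus a part anticommuting with it,
   the polynomial star product becomes a pointwise combination of [B] at
   [q] and at its conjugate. *)
Lemma norm_star_poly_le n (a b : nat -> H) x y q q' :
  q = x%:A + y *: I -> q' = x%:A - y *: I ->
  `|\sum_(k < n) \sum_(l < n) q ^+ (k + l) * (a k * b l)| <=
  `|\sum_(k < n) q ^+ k * a k| *
    (`|\sum_(l < n) q ^+ l * b l| + `|\sum_(l < n) q' ^+ l * b l|).
Proof.
move=> qE q'E; set A := \sum_(k < n) _ * a _; set B := \sum_(l < n) q ^+ _ * _.
set B' := \sum_(l < n) q' ^+ _ * _.
pose A1 := 2^-1 *: (A - I * A * I); pose A2 := 2^-1 *: (A + I * A * I).
have II := imaginary_unit_sqr.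
have I1 : I * A1 = A1 * I.
  rewrite /A1 -scalerAl -scalerAr mulrBr mulrBl !mulrA II -!mulrA II.
  by rewrite !mulN1r !mulrN !mulr1 !opprK addrC.
have I2 : I * A2 = - (A2 * I).
  rewrite /A2 -scalerAl -scalerAr -scalerN mulrDr mulrDl !mulrA II -!mulrA II.
  by rewrite !mulN1r !mulrN !mulr1 opprD opprK addrC.
have comm (s : R) (T J J' : H) : J * T = T * J' ->
    (x%:A + s *: J) * T = T * (x%:A + s *: J').
  by move=> JT; rewrite mulrDl mulrDr mulr_algl mulr_algr -scalerAl JT scalerAr.
have c1 : q * A1 = A1 * q by rewrite qE; apply: comm.
have c2 : q * A2 = A2 * q'.
  by rewrite qE q'E -scalerN; apply: comm; rewrite I2 mulrN.
have c1X l : q ^+ l * A1 = A1 * q ^+ l.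
  by elim: l => [|l IHl]; rewrite ?mul1r ?mulr1// !exprS -mulrA IHl !mulrA c1.
have c2X l : q ^+ l * A2 = A2 * q' ^+ l.
  by elim: l => [|l IHl]; rewrite ?mul1r ?mulr1// !exprS -mulrA IHl !mulrA c2.
have A12 : A = A1 + A2.
  rewrite /A1 /A2 -scalerDr addrACA addNr addr0 scalerDr -scalerDl.
  by rewrite (_ : 2^-1 + 2^-1 = 1 :> R) ?scale1r//; field.
have -> : \sum_(k < n) \sum_(l < n) q ^+ (k + l) * (a k * b l) = A1 * B + A2 * B'.
  rewrite exchange_big /= !mulr_sumr -big_split; apply: eq_bigr => l _ /=.
  rewrite !mulrA -c1X -c2X -mulrDl -mulrDr -A12 mulr_sumr mulr_suml.
  by apply: eq_bigr => k _; rewrite addnC exprD !mulrA.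
have nI := normq_imaginary_unit hI.
have nA s : `|s| = 1 -> `|2^-1 *: (A + s *: (I * A * I))| <= `|A|.
  move=> s1; rewrite normrZ ger0_norm ?invr_ge0// mulrC ler_pdivrMr//.
  by rewrite (le_trans (ler_normD _ _))// normrZ s1 mul1r !normqM nI mulr1 mul1r
    mulr_natr mulr2n.
rewrite mulrDr (le_trans (ler_normD _ _))// !normqM lerD// ler_wpM2r//.
  by have := nA (-1); rewrite normrN1 scaleN1r; exact.
by have := nA 1; rewrite normr1 scale1r; exact.
Qed.

End Slice.

Definition complex_quat (z : R[i]) : H := Quat (complex.Re z) (complex.Im z) 0 0.

Fact complex_quat_is_zmod_morphism : zmod_morphism complex_quat.
Proof. by move=> [a b] [c d]; apply/quat_eqP; split => /=; ring. Qed.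

Fact complex_quat_is_monoid_morphism : monoid_morphism complex_quat.
Proof. by split=> // -[a b] [c d]; apply/quat_eqP; split => /=; ring. Qed.

HB.instance Definition _ := GRing.isZmodMorphism.Build R[i] H complex_quat
  complex_quat_is_zmod_morphism.
HB.instance Definition _ := GRing.isMonoidMorphism.Build R[i] H complex_quat
  complex_quat_is_monoid_morphism.

Definition quat_i : H := Quat 0 1 0 0.
Definition quat_j : H := Quat 0 0 1 0.

Lemma imaginary_quat_i : imaginary_units quat_i.
Proof. by apply/imaginary_unitP; split => //=; ring. Qed.

Lemma norm_complex_quat z : `|z| = `|complex_quat z|%:C%C.
Proof. by rewrite normc_def [`|complex_quat z|]/(quat_norm _) /quat_norm /=
  !expr0n !addr0. Qed.

Lemma slice_exp_complex t : slice_exp quat_i t = complex_quat (Complex (cos t)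
  (sin t)).
Proof. by apply/quat_eqP; split => /=; ring. Qed.

Lemma normq_complex_decomp z w :
  `|complex_quat z + complex_quat w * quat_j| ^+ 2 =
  `|complex_quat z| ^+ 2 + `|complex_quat w| ^+ 2.
Proof. by rewrite !normq_sqr /quat_dot /=; ring. Qed.

End Quaternions.

(** * Integrals over the circle *)

Section CircleIntegral.
Context {R : realType}.
Notation H := (quat R).
Notation mu := (@lebesgue_measure R).
Notation circle := (`[(- pi)%R, (pi : R)]%classic : set R).

(** A nonnegative integral is a supremum over nonnegative simple functions below the integrand, and
    that family grows with the integrand. It is applied to norms of arbitrary total functions on
    circles. *)
Lemma ge0_le_integral_nonmeasurable d (T : measurableType d)
    (nu : {measure set T -> \bar R}) (D : set T) (f g : T -> \bar R) :
  (forall x, D x -> (0 <= f x)%E) -> (forall x, D x -> (f x <= g x)%E) ->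
  (\int[nu]_(x in D) f x <= \int[nu]_(x in D) g x)%E.
Proof.
move=> f0 fg; rewrite !(integral_mkcond D).
have g0 x : D x -> (0 <= g x)%E by move=> Dx; rewrite (le_trans (f0 _ Dx)) ?fg.
rewrite !ge0_integralTE; [|by move=> x; exact: erestrict_ge0..].
apply: le_ereal_sup => _ [h hf <-].
by exists h => // x; rewrite (le_trans (hf x))// lee_restrict.
Qed.

(** Integrability and value are bundled so that the linearity rules compose without side
    conditions. *)
Definition has_circle_integral (u : R -> R) (v : R) : Prop :=
  mu.-integrable circle (EFin \o u) /\
  (\int[mu]_(t in circle) (u t)%:E = v%:E)%E.

Lemma has_circle_integralD u1 u2 v1 v2 :
  has_circle_integral u1 v1 -> has_circle_integral u2 v2 ->
  has_circle_integral (fun t => u1 t + u2 t) (v1 + v2).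
Proof.
move=> [i1 e1] [i2 e2]; split.
  by apply: (@integrableD _ _ _ mu circle _ (EFin \o u1) (EFin \o u2)).
by rewrite EFinD -e1 -e2 -(@integralD _ _ _ mu circle (measurable_itv _) _ _ i1 i2).
Qed.

Lemma has_circle_integralZ c u v : has_circle_integral u v ->
  has_circle_integral (fun t => c * u t) (c * v).
Proof.
move=> [i e]; split.
  by apply: (@integrableZl _ _ _ mu circle _ c (EFin \o u)).
by rewrite EFinM -e -(@integralZl _ _ _ mu circle (measurable_itv _) _ i).
Qed.

Lemma mu_circle : mu circle = (2 * pi)%:E.
Proof.
rewrite lebesgue_measure_itv /= lte_fin gtrN ?pi_gt0// -EFinB opprK.
by rewrite mulr_natl mulr2n.
Qed.

Lemma has_circle_integral_cst c : has_circle_integral (fun=> c) (2 * pi * c).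
Proof.
split.
  apply: continuous_compact_integrable; first exact: segment_compact.
  by apply: continuous_subspaceT => x; exact: cvg_cst.
rewrite (@integral_cst _ _ _ mu circle (measurable_itv _) c%:E).
by rewrite [X in (_ * X)%E]mu_circle -EFinM mulrC.
Qed.

Lemma has_circle_integral_sum0 n (u : nat -> R -> R) :
  (forall k, (k < n)%N -> has_circle_integral (u k) 0) ->
  has_circle_integral (fun t => \sum_(k < n) u k t) 0.
Proof.
elim: n => [|n IHn] h.
  under eq_fun do rewrite big_ord0.
  by have := has_circle_integral_cst 0; rewrite mulr0.
under eq_fun do rewrite big_ord_recr.
have := has_circle_integralD (IHn (fun k kn => h k (ltnW kn))) (h n (ltnSn n)).
by rewrite addr0.
Qed.

Lemma has_circle_integral_trig n a b : (0 < n)%N ->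
  has_circle_integral (fun t => cos (n%:R * t) * a + sin (n%:R * t) * b) 0.
Proof.
move=> n0; set u := fun t : R => _.
have n_neq0 : n%:R != 0 :> R by rewrite pnatr_eq0 -lt0n.
(* An antiderivative of [u]; its values at the two endpoints agree because sin (n pi) = 0 and cos is
   even. *)
pose U t := n%:R^-1 * (sin (n%:R * t) * a - cos (n%:R * t) * b).
have dn (x : R) : is_derive x (1 : R) (fun t : R => n%:R * t) n%:R.
  have -> : (fun t : R => n%:R * t) = n%:R *: (@id R) by [].
  by apply: is_derive_eq; rewrite /GRing.scale/= mulr1.
have dU (x : R) : is_derive x (1 : R) U (u x).
  have ds : is_derive x (1 : R) (fun t : R => sin (n%:R * t)) (cos (n%:R * x) *
    n%:R).
    exact: (@is_derive1_comp _ sin (fun t : R => n%:R * t) x _ _ (is_derive_sin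
      _) (dn x)).
  have dc : is_derive x (1 : R) (fun t : R => cos (n%:R * t)) (- sin (n%:R * x)
    * n%:R).
    exact: (@is_derive1_comp _ cos (fun t : R => n%:R * t) x _ _ (is_derive_cos
      _) (dn x)).
  have -> : U = (n%:R^-1 * a) *: (fun t : R => sin (n%:R * t))
      - (n%:R^-1 * b) *: (fun t : R => cos (n%:R * t)).
    by apply/funext => t; rewrite /U !fctE /GRing.scale/=; ring.
  apply: is_derive_eq; rewrite /u /GRing.scale/=.
  by field.
have cu : {within circle, continuous u}.
  apply: continuous_subspaceT => x.
  have cn : {for x, continuous (fun t : R => n%:R * t)}.
    exact/differentiable_continuous/derivable1_diffP/(@ex_derive _ _ _ _ _ _ _
      (dn x)).
  apply: cvgD; apply: cvgMr_tmp; apply: continuous_comp => //.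
  - exact: continuous_cos.
  - exact: continuous_sin.
split; first by apply: continuous_compact_integrable => //; exact: segment_compact.
have pi_pi : (- pi < pi :> R) by rewrite gtrN ?pi_gt0.
rewrite (@continuous_FTC2 _ u U)//.
- rewrite -EFinB /U mulrN sinN cosN.
  have -> : sin (n%:R * pi) = 0 :> R.
    by rewrite mulr_natl; elim: (n) => [|m IHm]; rewrite ?mulr0n ?sin0// mulrS
      addrC sinDpi IHm oppr0.
  by rewrite oppr0 subrr.
- have cU x : U y @[y --> x] --> U x.
    exact/differentiable_continuous/derivable1_diffP/(@ex_derive _ _ _ _ _ _ _
      (dU x)).
  split; first by move=> x _; exact: (@ex_derive _ _ _ _ _ _ _ (dU x)).
  - exact/cvg_at_right_filter/cU.
  - exact/cvg_at_left_filter/cU.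
- by move=> x _; rewrite derive1E (@derive_val _ _ _ _ _ _ _ (dU x)).
Qed.

(** Induction on [n]: the cross terms of the new coefficient with an earlier [a m] have frequency n
    - m > 0 and integrate to 0. *)
Lemma parseval_slice (I : H) (a : nat -> H) n : imaginary_units I ->
  has_circle_integral (fun t => `|\sum_(k < n) slice_exp I t ^+ k * a k| ^+ 2)
    (2 * pi * \sum_(k < n) `|a k| ^+ 2).
Proof.
move=> hI; elim: n => [|n IHn].
  rewrite big_ord0; under eq_fun do rewrite big_ord0 normr0 expr0n.
  exact: has_circle_integral_cst.
pose w t := \sum_(m < n) (cos ((n - m)%:R * t) * quat_dot (a m) (a n)
  + sin ((n - m)%:R * t) * quat_dot (a m) (I * a n)).
have w0 : has_circle_integral w 0.
  apply: (@has_circle_integral_sum0 n (fun m t => cos ((n - m)%:R * t) *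
    quat_dot (a m) (a n)
    + sin ((n - m)%:R * t) * quat_dot (a m) (I * a n))) => k kn.
  by apply: has_circle_integral_trig; rewrite subn_gt0.
have := has_circle_integralD (has_circle_integralD IHn (has_circle_integralZ 2 w0))
  (has_circle_integral_cst (`|a n| ^+ 2)).
rewrite mulr0 addr0 big_ord_recr/= -mulrDr.
congr (has_circle_integral _ _); apply/funext => t; rewrite big_ord_recr/=.
rewrite normq_sqrD; congr (_ + 2 * _ + _); last first.
  by rewrite normqM normqX normq_slice_exp// expr1n mul1r.
rewrite quat_dot_suml; apply: eq_bigr => m _.
by rewrite !slice_expX// quat_dot_slice_exp// -mulrBl natrB// ltnW.
Qed.

Lemma circle_integral_le_approx (u g : R -> R) v e :
  has_circle_integral u v -> (forall t, 0 <= u t) -> (forall t, 0 <= g t) -> 0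
    <= e ->
  (forall t, u t <= g t + e) ->
  (v%:E <= \int[mu]_(t in circle) (g t)%:E + (2 * pi * e)%:E)%E.
Proof.
move=> [iu <-] u0 g0 e0 ug.
(* [g] is not assumed measurable, so [e] is split off the measurable [h] instead. *)
pose h t := Num.max (u t - e) 0.
have mu_u : measurable_fun circle u.
  by have /integrableP[/measurable_EFinP] := iu.
have mh : measurable_fun circle h.
  by apply: measurable_maxr => //; apply: measurable_funB.
have [_ <-] := has_circle_integral_cst e.
apply: (@le_trans _ _ (\int[mu]_(t in circle) ((h t)%:E + e%:E))%E); last first.
  rewrite ge0_integralD//=; last 2 first.
  - by move=> t _; rewrite lee_fin le_max lexx orbT.
  - exact/measurable_EFinP.
  rewrite leeD2r//; apply: ge0_le_integral_nonmeasurable => t _; rewrite lee_fin.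
    by rewrite le_max lexx orbT.
  by rewrite ge_max g0 andbT lerBlDr.
apply: ge0_le_integral_nonmeasurable => t _; rewrite ?lee_fin//.
by rewrite -lerBlDr le_max lexx.
Qed.

End CircleIntegral.

(** * Quaternionic power series *)

Section PowerSeries.
Context {R : realType}.
Notation H := (quat R).
Implicit Types (u a b : nat -> H) (f : H -> H) (q l : H) (x K r e : R) (N n : nat).

Lemma cvg_quat {T} {F : set_system T} {FF : Filter F} (u : T -> H) l :
  qre (u t) @[t --> F] --> qre l -> qi (u t) @[t --> F] --> qi l ->
  qj (u t) @[t --> F] --> qj l -> qk (u t) @[t --> F] --> qk l ->
  u @ F --> l.
Proof.
move=> /cvgrPdist_le h1 /cvgrPdist_le h2 /cvgrPdist_le h3 /cvgrPdist_le h4.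
apply/cvgrPdist_le => e e0; have e4 : 0 < e / 4 by rewrite divr_gt0.
near=> t.
rewrite (le_trans (norm_le_coords _))// (_ : e = e / 4 + e / 4 + e / 4 + e / 4);
  last by field.
by rewrite !lerD//; near: t; [exact: h1|exact: h2|exact: h3|exact: h4].
Unshelve. all: by end_near. Qed.

Lemma cvg_quat_series_geometric u K x : 0 <= x < 1 ->
  (forall n, `|u n| <= K * x ^+ n) -> cvgn (series u).
Proof.
move=> /andP[x0 x1] hu.
have x1' : `|x| < 1 by rewrite ger0_norm.
have coord (h : H -> R) : {morph h : p q / p + q} -> h 0 = 0 ->
    (forall q, `|h q| <= `|q|) -> exists y : R, h (series u n) @[n --> \oo] --> y.
  move=> hD h0 hle; exists (limn (series (h \o u))).
  have -> : (fun n => h (series u n)) = series (h \o u).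
    by apply/funext => n; rewrite /series /= (big_morph h hD h0).
  apply: normed_cvg; apply: (@series_le_cvg _ _ (geometric K x)) => //.
  - by move=> n; exact: normr_ge0.
  - by move=> n; exact: le_trans (normr_ge0 _) (hu n).
  - by move=> n; exact: le_trans (hle _) (hu n).
  - exact: is_cvg_geometric_series.
have [l1 c1] := coord _ qreD erefl qre_le_norm.
have [l2 c2] := coord _ qiD erefl qi_le_norm.
have [l3 c3] := coord _ qjD erefl qj_le_norm.
have [l4 c4] := coord _ qkD erefl qk_le_norm.
by apply/cvg_ex; exists (Quat l1 l2 l3 l4); apply: cvg_quat.
Qed.

Lemma norm_series_diff u K x N d : 0 <= x < 1 ->
  (forall n, `|u n| <= K * x ^+ n) ->
  `|series u (N + d)%N - series u N| <= K * x ^+ N / (1 - x).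
Proof.
move=> /andP[x0 x1] hu; have x1' : 0 < 1 - x by rewrite subr_gt0.
have K0 : 0 <= K by have := hu 0; rewrite expr0 mulr1; exact: le_trans.
(* Keeping the factor 1 - x^d, the exact finite geometric sum, makes the induction on [d] close. *)
apply: (@le_trans _ _ (K * x ^+ N * (1 - x ^+ d) / (1 - x))); last first.
  rewrite ler_wpM2r ?invr_ge0 ?(ltW x1')// ler_piMr ?mulr_ge0 ?exprn_ge0//.
  by rewrite gerBl exprn_ge0.
elim: d => [|d IHd]; first by rewrite addn0 subrr normr0 expr0 subrr mulr0 mul0r.
rewrite addnS {1}/series /= big_nat_recr//= addrAC.
rewrite (le_trans (ler_normD _ _))// (le_trans (lerD IHd (hu _)))//.
rewrite exprD exprS le_eqVlt; apply/orP; left; apply/eqP; field.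
by rewrite gt_eqF.
Qed.

Lemma norm_series_tail u K x l N : 0 <= x < 1 ->
  (forall n, `|u n| <= K * x ^+ n) -> series u @ \oo --> l ->
  `|l - series u N| <= K * x ^+ N / (1 - x).
Proof.
move=> hx hu /cvgrPdist_le cu; apply/ler_addgt0Pr => e e0.
have [M _ hM] := cu e e0; have := hM (N + M)%N (leq_addl _ _) => /= h.
rewrite -(subrKA (series u (N + M)%N)) (le_trans (ler_normD _ _))// addrC.
by rewrite lerD// norm_series_diff.
Qed.

Lemma unit_ballP q : unit_ball q <-> `|q| < 1.
Proof. by []. Qed.

Lemma normq_real x : 0 <= x -> `|x%:A : H| = x.
Proof. by move=> x0; rewrite normrZ normq1 mulr1 ger0_norm. Qed.

(** Convergence at the real point [x] sends the terms to 0, so they are eventually at most 1; the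
    finitely many others are added to the bound. *)
Lemma expansion_coef_bound f a x : 0 <= x < 1 -> expansion f a ->
  exists2 K, 0 <= K & forall n, `|a n| * x ^+ n <= K.
Proof.
move=> /andP[x0 x1] fa; have /fa cf : unit_ball (x%:A : H).
  by rewrite unit_ballP normq_real.
have /cvgr0_norm_le c0 := cvg_series_cvg_0 (cvgP _ cf).
have [M _ hM] := c0 1 ltr01.
exists (1 + \sum_(k < M) `|a k| * x ^+ k).
  by rewrite addr_ge0// sumr_ge0// => k _; rewrite mulr_ge0 ?exprn_ge0.
move=> n; have [nM|Mn] := ltnP n M.
  rewrite (bigD1 (Ordinal nM))//= addrCA lerDl addr_ge0// sumr_ge0// => k _.
  by rewrite mulr_ge0 ?exprn_ge0.
have := hM n Mn; rewrite normqM normqX normq_real// mulrC => h.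
rewrite (le_trans h)// lerDl sumr_ge0// => k _.
by rewrite mulr_ge0 ?exprn_ge0.
Qed.

Lemma norm_term_le a K x q n : 0 < x -> (forall n, `|a n| * x ^+ n <= K) ->
  `|q ^+ n * a n| <= K * (`|q| / x) ^+ n.
Proof.
move=> x0 hK; rewrite normqM normqX expr_div_n mulrCA ler_wpM2l ?exprn_ge0//.
by rewrite ler_pdivlMr ?exprn_gt0.
Qed.

Lemma expansion_unif f a r e : 0 <= r < 1 -> 0 < e -> expansion f a ->
  exists M, forall N q, (M <= N)%N -> `|q| = r ->
    `|f q - \sum_(k < N) q ^+ k * a k| <= e.
Proof.
(* The midpoint of [r] and 1: a coefficient bound at radius [x] makes the terms on |q| = r decay
   like (r/x)^n, uniformly in [q]. *)
move=> /andP[r0 r1] e0 fa; pose x := (r + 1) / 2.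
have x0 : 0 < x by rewrite /x; lra.
have x1 : 0 <= x < 1 by rewrite /x; lra.
have rx : 0 <= r / x < 1 by rewrite divr_ge0 ?(ltW x0)//= ltr_pdivrMr// mul1r
  /x; lra.
have [K K0 hK] := expansion_coef_bound x1 fa.
have rx1 : `|r / x| < 1 by rewrite ger0_norm; case/andP: rx.
have /cvgr0_norm_le/(_ _ e0)[M _ hM] := cvg_geometric (K / (1 - r / x)) rx1.
exists M => N q MN qr; have qb : unit_ball q by rewrite unit_ballP qr.
have tail : forall n, `|q ^+ n * a n| <= K * (r / x) ^+ n.
  by move=> n; rewrite -qr; apply: norm_term_le.
have := norm_series_tail N rx tail (fa q qb); rewrite /series /= big_mkord => h.
rewrite (le_trans h)// mulrAC (le_trans (ler_norm _))//.
exact: hM.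
Qed.

Lemma cvg_power_series a K q : (forall n, `|a n| <= K) -> unit_ball q ->
  cvgn (series (fun n => q ^+ n * a n)).
Proof.
move=> hK qb; apply: (@cvg_quat_series_geometric _ K `|q|).
  by rewrite normr_ge0.
move=> n; rewrite -[in leRHS](divr1 `|q|); apply: norm_term_le => // m.
by rewrite expr1n mulr1.
Qed.

(** Once the earlier coefficients vanish, the term of degree [n] at a small real point [x] cancels a
    tail of order x^(n+1), whence |a_n| <= C x. *)
Lemma expansion0_eq0 a : expansion (fun=> 0) a -> forall n, a n = 0.
Proof.
move=> fa; have h2 : 0 <= (2^-1 : R) < 1 by lra.
have [K K0 hK] := expansion_coef_bound h2 fa.
elim/ltn_ind => n IHn; apply/eqP; rewrite -normr_le0; apply/ler_addgt0Pr => e e0.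
rewrite add0r; pose C := 2 * K * 2 ^+ n.+1.
have C0 : 0 <= C by rewrite !mulr_ge0 ?exprn_ge0.
(* At most 1/4, so that 1 / (1 - 2x) <= 2, and small enough that C x <= e. *)
pose x := Num.min 4^-1 (e / (C + 1)).
have x0 : 0 < x by rewrite lt_min invr_gt0 ltr0n divr_gt0// ltr_wpDl.
have x4 : x <= 4^-1 by rewrite ge_min lexx.
have xC : x * (C + 1) <= e.
  by rewrite -ler_pdivlMr ?ltr_wpDl// ge_min lexx orbT.
have xq : `|x%:A : H| = x by rewrite normq_real ?ltW.
have xb : unit_ball (x%:A : H) by rewrite unit_ballP xq; lra.
have tail m : `|(x%:A : H) ^+ m * a m| <= K * (2 * x) ^+ m.
  rewrite [2 * x]mulrC -[in leRHS]xq -[2]invrK.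
  by apply: (@norm_term_le a K 2^-1) => //; rewrite invr_gt0.
have x2 : 0 <= 2 * x < 1 by lra.
have := norm_series_tail n.+1 x2 tail (fa _ xb).
rewrite /series /= sub0r normrN big_mkord big_ord_recr/= big1 ?add0r; last first.
  by move=> k _; rewrite IHn ?mulr0.
rewrite normqM normqX xq exprMn => h.
have d2 : (1 - 2 * x)^-1 <= 2.
  by rewrite -[leRHS]invrK lef_pV2 ?posrE; lra.
have : x ^+ n * `|a n| <= x ^+ n * (x * C).
  rewrite (le_trans h)//.
  have -> : x ^+ n * (x * C) = K * (2 ^+ n.+1 * x ^+ n.+1) * 2.
    by rewrite /C !exprS; ring.
  by rewrite ler_wpM2l// !mulr_ge0 ?exprn_ge0 ?(ltW x0).
rewrite ler_pM2l ?exprn_gt0// => /le_trans -> //.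
by rewrite (le_trans _ xC)// ler_wpM2l ?(ltW x0)// lerDl.
Qed.

Lemma coefsE f a : expansion f a -> coefs f = a.
Proof.
move=> fa; have fc : expansion f (coefs f) by apply: xgetPex; exists a.
apply/funext => n; apply/eqP; rewrite -subr_eq0; apply/eqP; move: n.
apply: expansion0_eq0 => q qb.
have -> : series (fun n => q ^+ n * (coefs f n - a n)) =
  series (fun n => q ^+ n * coefs f n) - series (fun n => q ^+ n * a n).
  apply/funext => n; rewrite /series /= fctE /= -sumrB; apply: eq_bigr => k _.
  by rewrite mulrBr.
by rewrite -(subrr (f q)); apply: cvgB; [exact: fc|exact: fa].
Qed.

Lemma expansion_coefs f : regular f -> expansion f (coefs f).
Proof. by move=> rf; apply: xgetPex. Qed.

(** A uniform bound on real partial sums stands in for summability, since it passes directly to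
    coefficientwise limits. *)
Definition square_bounded M a : Prop := forall N, \sum_(k < N) `|a k| ^+ 2 <= M.

Lemma square_bounded_coef M a n : square_bounded M a -> `|a n| ^+ 2 <= M.
Proof.
move=> /(_ n.+1); rewrite big_ord_recr/=; apply: le_trans.
by rewrite lerDr sumr_ge0// => k _; rewrite exprn_ge0.
Qed.

Lemma hardy2_square_bounded f : hardy2 f -> exists M, square_bounded M (coefs f).
Proof.
move=> [rf]; set S := (X in (X < +oo)%E) => fin.
have S0 : (0 <= S)%E by apply: nneseries_ge0 => n _ _; rewrite lee_fin exprn_ge0.
exists (fine S) => N; rewrite -lee_fin fineK; last by rewrite ge0_fin_numE.
rewrite -sumEFin -(big_mkord xpredT (fun k => (`|coefs f k| ^+ 2)%:E)).
by apply: nneseries_lim_ge => n _ _; rewrite lee_fin exprn_ge0.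
Qed.

Definition power_series a : H -> H := fun q => limn (series (fun n => q ^+ n * a
  n)).

Lemma expansion_power_series a K : (forall n, `|a n| <= K) ->
  expansion (power_series a) a.
Proof. by move=> hK q qb; apply: (cvg_power_series hK qb). Qed.

Lemma hardy2_power_series M a : square_bounded M a ->
  hardy2 (power_series a) /\ coefs (power_series a) = a.
Proof.
move=> sa.
have hK n : `|a n| <= M + 1.
  have := square_bounded_coef n sa; nra.
have ea := expansion_power_series hK.
have ca := coefsE ea; split=> //; split; first by exists a.
rewrite ca (@le_lt_trans _ _ M%:E) ?ltry//; apply: lime_le.
  by apply: is_cvg_nneseries => n _ _; rewrite lee_fin exprn_ge0.
by apply: nearW => N; rewrite big_mkord sumEFin lee_fin.
Qed.

End PowerSeries.

(** * Star products *)

Section StarProduct.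
Context {R : realType}.
Notation H := (quat R).
Notation mu := (@lebesgue_measure R).
Notation circle := (`[(- pi)%R, (pi : R)]%classic : set R).
Implicit Types (a b : nat -> H) (f g : H -> H) (p q I : H) (r t : R).

Definition cauchy_product a b n : H := \sum_(k < n.+1) a k * b (n - k)%N.

(** The termwise estimate xy <= x^2 + y^2 suffices, as any bound independent of [n] will do. *)
Lemma cauchy_product_le Ma Mb a b n : square_bounded Ma a -> square_bounded Mb b ->
  `|cauchy_product a b n| <= Ma + Mb.
Proof.
move=> ha hb; rewrite (le_trans (ler_norm_sum _ _ _))//.
apply: (@le_trans _ _ (\sum_(k < n.+1) (`|a k| ^+ 2 + `|b (n - k)%N| ^+ 2))).
  by apply: ler_sum => k _; rewrite normqM; nra.
rewrite big_split lerD ?(ha n.+1)//= (reindex_inj rev_ord_inj)/=.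
apply: (le_trans _ (hb n.+1)); apply: ler_sum => k _.
by rewrite subSS subKn// -ltnS.
Qed.

Lemma square_bounded_le M a b : (forall n, `|a n| <= `|b n|) ->
  square_bounded M b -> square_bounded M a.
Proof.
move=> ab hb N; apply: (le_trans _ (hb N)); apply: ler_sum => k _.
by rewrite ler_pXn2r ?nnegrE.
Qed.

(** Groups the index square by n = k + l. The coefficients multiply in order in [{poly H}], where
    ['X] commutes with them. *)
Lemma sum_cauchy_product_poly q a b N :
  \sum_(k < N) \sum_(l < N) q ^+ (k + l) * (a k * b l) =
  \sum_(n < N + N) q ^+ n * (\poly_(k < N) a k * \poly_(l < N) b l)`_n.
Proof.
have -> : \poly_(k < N) a k * \poly_(l < N) b l =
    \sum_(k < N) \sum_(l < N) (a k * b l) *: 'X^(k + l).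
  rewrite !poly_def mulr_suml; apply: eq_bigr => k _.
  rewrite mulr_sumr; apply: eq_bigr => l _.
  rewrite -!mul_polyC -mulrA [in LHS](mulrA 'X^k) -(commr_polyXn _ k).
  by rewrite polyCM exprD !mulrA.
transitivity (\sum_(n < N + N) \sum_(k < N) \sum_(l < N)
    if n == (k + l)%N :> nat then q ^+ n * (a k * b l) else 0); last first.
  apply: eq_bigr => n _; rewrite coef_sum mulr_sumr; apply: eq_bigr => k _.
  rewrite coef_sum mulr_sumr; apply: eq_bigr => l _.
  by rewrite coefZ coefXn; case: eqP => _; rewrite ?mulr1 ?mulr0.
rewrite [RHS]exchange_big; apply: eq_bigr => k _; rewrite [RHS]exchange_big.
apply: eq_bigr => l _; rewrite -[RHS]big_mkcond/=.
have kl : (k + l < N + N)%N by rewrite -addSn leq_add// ltnW.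
by rewrite (big_pred1 (Ordinal kl)).
Qed.

Lemma norm_scale_slice_exp I r t : imaginary_units I -> 0 <= r ->
  `|r *: slice_exp I t| = r.
Proof. by move=> hI r0; rewrite normrZ normq_slice_exp// mulr1 ger0_norm. Qed.

Lemma imaginary_unitsN I : imaginary_units I -> imaginary_units (- I).
Proof. by rewrite /imaginary_units /= sqrrN. Qed.

Lemma parseval_circle I r a N M : imaginary_units I -> 0 <= r <= 1 ->
  square_bounded M a ->
  exists2 v, v <= 2 * pi * M &
    has_circle_integral (fun t => `|\sum_(k < N) (r *: slice_exp I t) ^+ k * a
      k| ^+ 2) v.
Proof.
move=> hI /andP[r0 r1] ha; exists (2 * pi * \sum_(k < N) `|r ^+ k *: a k| ^+ 2).
  rewrite ler_wpM2l ?mulr_ge0 ?pi_ge0// (le_trans _ (ha N))//.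
  apply: ler_sum => k _; rewrite ler_pXn2r ?nnegrE// normrZ ger0_norm ?exprn_ge0//.
  by rewrite ler_piMl// exprn_ile1.
have := parseval_slice (fun k => r ^+ k *: a k) N hI.
congr (has_circle_integral _ _); apply/funext => t; congr (`|_| ^+ 2).
by apply: eq_bigr => k _; rewrite exprZn -scalerAl -scalerAr.
Qed.

(** [g] is replaced by the star product of two truncations, to which the slice inequality applies.
    Two errors of at most 1/2 account for the final 1, and [W] is an integrable majorant. *)
Lemma norm_star_le_circle I r Ma Mb a b g : imaginary_units I -> 0 < r < 1 ->
  square_bounded Ma a -> square_bounded Mb b ->
  expansion g (cauchy_product a b) ->
  exists W v, [/\ has_circle_integral W v, v <= 2 * pi * (Ma + Mb) &
    forall t, `|g (r *: slice_exp I t)| <= W t + 1].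
Proof.
move=> hI /andP[r0 r1] ha hb eg.
have r01 : 0 <= r < 1 by rewrite ltW.
have r01' : 0 <= r <= 1 by rewrite !ltW.
have e0 : (0 : R) < 2^-1 by rewrite invr_gt0.
have [M1 hM1] := expansion_unif r01 e0 eg.
set K := Ma + Mb.
have r1' : `|r| < 1 by rewrite ger0_norm ?(ltW r0).
have /cvgr0_norm_le/(_ _ e0)[M2 _ hM2] := cvg_geometric (K / (1 - r)) r1'.
pose N := maxn M1 M2.
have [va lva iA] := parseval_circle N hI r01' ha.
have [vb lvb iB] := parseval_circle N hI r01' hb.
have [vb' lvb' iB'] := parseval_circle N (imaginary_unitsN hI) r01' hb.
(* [W] is |A(q)|^2 + (|B(q)|^2 + |B(q')|^2) / 2, the AM-GM bound for |A(q)| (|B(q)| + |B(q')|);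
   these weights give the mean bound [Ma + Mb]. *)
have := has_circle_integralD iA
  (has_circle_integralZ 2^-1 (has_circle_integralD iB iB')).
set W := fun t : R => _; set v := _ + _ => iW; exists W, v; split => //.
  by rewrite /v /K mulrDr; lra.
move=> t; pose q := r *: slice_exp I t.
have nq : `|q| = r by rewrite norm_scale_slice_exp// ltW.
have h1 := hM1 N q (leq_maxl _ _) nq.
pose d n := (\poly_(k < N) a k * \poly_(l < N) b l)`_n.
have dK n : `|q ^+ n * d n| <= K * r ^+ n.
  rewrite normqM normqX nq mulrC ler_wpM2r ?exprn_ge0 ?(ltW r0)// /d coefM.
  apply: (cauchy_product_le n).
    by apply: square_bounded_le ha => k; rewrite coef_poly; case: ifP; rewrite
      ?normr0.
  by apply: square_bounded_le hb => k; rewrite coef_poly; case: ifP; rewrite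
    ?normr0.
(* Below degree [N] the product of the truncations has the exact coefficients; its further terms lie
   in a geometric tail. *)
have h2 : `|\sum_(n < N + N) q ^+ n * d n - \sum_(n < N) q ^+ n * d n| <= 2^-1.
  have := norm_series_diff N N r01 dK; rewrite /series /= !big_mkord => h.
  rewrite (le_trans h)// mulrAC (le_trans (ler_norm _))//.
  exact: (hM2 N (leq_maxr _ _)).
have dc : \sum_(n < N) q ^+ n * d n = \sum_(n < N) q ^+ n * cauchy_product a b n.
  apply: eq_bigr => n _; congr (_ * _); rewrite /d coefM; apply: eq_bigr => k _.
  rewrite !coef_poly (leq_ltn_trans (leq_subr _ _) (ltn_ord n)).
  by rewrite (leq_ltn_trans _ (ltn_ord n))// -ltnS.
have h3 : `|\sum_(n < N + N) q ^+ n * d n| <= W t.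
  rewrite -sum_cauchy_product_poly.
  apply: le_trans (norm_star_poly_le hI N a b (x := r * cos t) (y := r * sin t)
    (q' := r *: slice_exp (- I) t) _ _) _.
  - by rewrite /q /slice_exp scalerDr !scalerA.
  - by rewrite /slice_exp scalerDr !scalerA scalerN.
  have amgm (x y z : R) : x * (y + z) <= x ^+ 2 + 2^-1 * (y ^+ 2 + z ^+ 2).
    have := sqr_ge0 (x - y); have := sqr_ge0 (x - z); nra.
  exact: amgm.
rewrite -/q; have -> : g q = (g q - \sum_(n < N) q ^+ n * cauchy_product a b n)
   - (\sum_(n < N + N) q ^+ n * d n - \sum_(n < N) q ^+ n * d n)
   + \sum_(n < N + N) q ^+ n * d n.
  by rewrite dc opprB addrA subrK subrK.
rewrite (le_trans (ler_normD _ _))// addrC lerD//.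
by rewrite (le_trans (ler_normB _ _))// [leRHS](splitr 1) !mul1r lerD.
Qed.

Lemma star_sum_hardy1 f f1 g1 f2 g2 :
  hardy2 f1 -> hardy2 g1 -> hardy2 f2 -> hardy2 g2 ->
  (forall q, unit_ball q -> f q = star f1 g1 q + star f2 g2 q) -> hardy1 f.
Proof.
move=> h1 k1 h2 k2 fE.
have [m1 b1] := hardy2_square_bounded h1; have [n1 c1] := hardy2_square_bounded k1.
have [m2 b2] := hardy2_square_bounded h2; have [n2 c2] := hardy2_square_bounded k2.
have e1 : expansion (star f1 g1) (cauchy_product (coefs f1) (coefs g1)).
  exact: expansion_power_series (fun n => cauchy_product_le n b1 c1).
have e2 : expansion (star f2 g2) (cauchy_product (coefs f2) (coefs g2)).
  exact: expansion_power_series (fun n => cauchy_product_le n b2 c2).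
split.
  exists (fun n => cauchy_product (coefs f1) (coefs g1) n
    + cauchy_product (coefs f2) (coefs g2) n) => q qb.
  rewrite fE//; set u := series _.
  have -> : u = series (fun n => q ^+ n * cauchy_product (coefs f1) (coefs g1) n)
      + series (fun n => q ^+ n * cauchy_product (coefs f2) (coefs g2) n).
    apply/funext => n; rewrite /u /series /= fctE /= -big_split/=.
    by apply: eq_bigr => k _; rewrite mulrDr.
  by apply: cvgD; [exact: e1|exact: e2].
(* The 2 collects the additive errors of the two star products. *)
apply: (@le_lt_trans _ _ (m1 + n1 + (m2 + n2) + 2)%:E); last by rewrite ltry.
apply: ge_ereal_sup => _ [I hI <-]; apply: ge_ereal_sup => _ [r r01 <-].
have {}r01 : 0 < r < 1 by move: r01; rewrite /= in_itv.
have [W1 [v1 [i1 l1 p1]]] := norm_star_le_circle hI r01 b1 c1 e1.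
have [W2 [v2 [i2 l2 p2]]] := norm_star_le_circle hI r01 b2 c2 e2.
have [_ iW] := has_circle_integralD (has_circle_integralD i1 i2)
  (has_circle_integral_cst 2).
have pi0 : 0 < 2 * pi :> R by rewrite mulr_gt0 ?pi_gt0.
have r0 : 0 <= r by case/andP: r01 => /ltW.
rewrite /circle_mean.
apply: (@le_trans _ _ ((2 * pi)^-1%:E * (v1 + v2 + 2 * pi * 2)%:E)%E).
  rewrite lee_wpmul2l ?lee_fin ?invr_ge0 ?(ltW pi0)// -iW.
  apply: ge0_le_integral_nonmeasurable => t _; rewrite lee_fin//.
  rewrite fE; last by rewrite unit_ballP norm_scale_slice_exp//; case/andP: r01.
  have := p1 t; have := p2 t; have := ler_normD (star f1 g1 (r *: slice_exp I t))
    (star f2 g2 (r *: slice_exp I t)); lra.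
rewrite -EFinM lee_fin mulrC ler_pdivrMr//; lra.
Qed.

End StarProduct.

(** * Riesz factorization *)

Section Compactness.
Context {R : realType}.
Notation H := (quat R).

Lemma cvg_quat_coord {T} {F : set_system T} {FF : Filter F} (u : T -> H) (l : H)
    (h : H -> R) :
  (forall p q, h (p - q) = h p - h q) -> (forall q, `|h q| <= `|q|) ->
  u @ F --> l -> h (u t) @[t --> F] --> h l.
Proof.
move=> hB hle /cvgrPdist_le cu; apply/cvgrPdist_le => e e0.
near=> t; rewrite -hB (le_trans (hle _))//; near: t; exact: cu.
Unshelve. all: by end_near. Qed.

Lemma cvg_quatM {T} {F : set_system T} {FF : Filter F} (u v : T -> H) (l m : H) :
  u @ F --> l -> v @ F --> m -> u t * v t @[t --> F] --> l * m.
Proof.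
move=> cu cv.
have u1 := @cvg_quat_coord _ _ FF _ _ _ (fun _ _ => erefl) qre_le_norm cu.
have u2 := @cvg_quat_coord _ _ FF _ _ _ (fun _ _ => erefl) qi_le_norm cu.
have u3 := @cvg_quat_coord _ _ FF _ _ _ (fun _ _ => erefl) qj_le_norm cu.
have u4 := @cvg_quat_coord _ _ FF _ _ _ (fun _ _ => erefl) qk_le_norm cu.
have v1 := @cvg_quat_coord _ _ FF _ _ _ (fun _ _ => erefl) qre_le_norm cv.
have v2 := @cvg_quat_coord _ _ FF _ _ _ (fun _ _ => erefl) qi_le_norm cv.
have v3 := @cvg_quat_coord _ _ FF _ _ _ (fun _ _ => erefl) qj_le_norm cv.
have v4 := @cvg_quat_coord _ _ FF _ _ _ (fun _ _ => erefl) qk_le_norm cv.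
apply: cvg_quat => /=.
- by apply: cvgB; [apply: cvgB; [apply: cvgB|]|]; apply: cvgM.
- by apply: cvgB; [apply: cvgD; [apply: cvgD|]|]; apply: cvgM.
- by apply: cvgD; [apply: cvgD; [apply: cvgB|]|]; apply: cvgM.
- by apply: cvgD; [apply: cvgB; [apply: cvgD|]|]; apply: cvgM.
Qed.

(** The image of an ultrafilter is an ultrafilter, and it contains the compact segment [-K, K]. *)
Lemma ultra_cvg_real (U : set_system nat) (u : nat -> R) K : UltraFilter U ->
  (forall n, `|u n| <= K) -> exists l : R, u @ U --> l.
Proof.
move=> UU hu; have := @segment_compact R (- K) K.
rewrite compact_ultra => /(_ (u @ U)) [||l [_ cl]]; last by exists l.
  split; first exact: fmap_proper_filter.
  move=> G GG sG; apply/seteqP; split=> // B GB.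
  have [//|UnB] := in_ultra_setVsetC (u @^-1` B) UU.
  exfalso; apply: (@filter_not_empty _ G GG); rewrite -(setICr B); apply:
    filterI => //; exact: sG.
apply: (@filterE _ U) => n; rewrite /= in_itv/= -ler_norml; exact: hu.
Qed.

Lemma ultra_cvg_quat (U : set_system nat) (u : nat -> H) K : UltraFilter U ->
  (forall n, `|u n| <= K) -> exists l : H, u @ U --> l.
Proof.
move=> UU hu.
have [l1 c1] := ultra_cvg_real UU (fun n => le_trans (qre_le_norm _) (hu n)).
have [l2 c2] := ultra_cvg_real UU (fun n => le_trans (qi_le_norm _) (hu n)).
have [l3 c3] := ultra_cvg_real UU (fun n => le_trans (qj_le_norm _) (hu n)).
have [l4 c4] := ultra_cvg_real UU (fun n => le_trans (qk_le_norm _) (hu n)).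
by exists (Quat l1 l2 l3 l4); apply: cvg_quat.
Qed.

Lemma cvg_sum_ord {V : normedModType R} {T} {F : set_system T} {FF : Filter F}
    n (f : nat -> T -> V) (l : nat -> V) :
  (forall k, (k < n)%N -> f k @ F --> l k) ->
  \sum_(k < n) f k t @[t --> F] --> \sum_(k < n) l k.
Proof.
elim: n => [|n IHn] h.
  by rewrite big_ord0; under eq_fun do rewrite big_ord0; exact: cvg_cst.
rewrite big_ord_recr; under eq_fun do rewrite big_ord_recr.
by apply: cvgD; [apply: IHn => k kn; apply: h; exact: ltnW|exact: h].
Qed.

(** One ultrafilter finer than [\oo] gives limits of all coefficients at once, in place of a
    diagonal subsequence. Partial l2 sums and Cauchy coefficients are finite sums, so they pass to
    the limit. *)
Lemma cauchy_product_compact (s t : nat -> nat -> H) (c : nat -> H) M :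
  (forall j, square_bounded M (s j)) -> (forall j, square_bounded M (t j)) ->
  (forall n, cauchy_product (s j) (t j) n @[j --> \oo] --> c n) ->
  exists a b : nat -> H, [/\ square_bounded M a, square_bounded M b &
    forall n, c n = cauchy_product a b n].
Proof.
move=> hs ht hc.
have [U [UU leU]] := ultraFilterLemma (@eventually_filter).
have bnd (w : nat -> nat -> H) : (forall j, square_bounded M (w j)) ->
    exists a : nat -> H, forall k, w j k @[j --> U] --> a k.
  move=> hw; suff /choice[a ca] : forall k, exists l : H, w j k @[j --> U] --> l.
    by exists a.
  move=> k; apply: (@ultra_cvg_quat _ _ (M + 1) UU) => j.
  have := square_bounded_coef k (hw j); nra.
have lim_bnd (w : nat -> nat -> H) (a : nat -> H) : (forall j, square_bounded M
  (w j)) ->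
    (forall k, w j k @[j --> U] --> a k) -> square_bounded M a.
  move=> hw ca N.
  have cN : \sum_(k < N) `|w j k| ^+ 2 @[j --> U] --> \sum_(k < N) `|a k| ^+ 2.
    apply: (@cvg_sum_ord R^o _ _ _ N (fun k j => `|w j k| ^+ 2) (fun k => `|a k|
      ^+ 2)) => k _.
    rewrite expr2; under eq_fun do rewrite expr2.
    by apply: (@cvgM R); apply: cvg_norm; exact: ca.
  rewrite -(cvg_lim (@Rhausdorff R) cN); apply: limr_le; first exact: cvgP cN.
  by apply: nearW => j; exact: hw.
have [a ca] := bnd s hs; have [b cb] := bnd t ht.
exists a, b; split; [exact: lim_bnd ca|exact: lim_bnd cb|move=> n].
have cU : cauchy_product (s j) (t j) n @[j --> U] --> c n.
  by apply: cvg_trans (hc n); apply: cvg_app.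
apply: (cvg_unique (@norm_hausdorff _ _) cU).
by apply: (@cvg_sum_ord H _ _ _ n.+1 (fun k j => s j k * t j (n - k)%N)
  (fun k => a k * b (n - k)%N)) => k _; apply: cvg_quatM.
Qed.

End Compactness.

(** * Polynomial factorization with control by circle means *)

Section Factorization.
Context {R : realType}.
Notation H := (quat R).
Notation C := (R[i]).
Notation mu := (@lebesgue_measure R).
Notation circle := (`[(- pi)%R, (pi : R)]%classic : set R).
Notation zexp t := (Complex (cos t) (sin t) : C).

Lemma archimedean_complex (e : C) : 0 < e -> exists n, n.+1%:R^-1 <= e.
Proof.
move=> e0; have eE : (complex.Re e)%:C%C = e by rewrite RRe_real// gtr0_real.
have : 0 < complex.Re e by rewrite -ltcR eE.
move=> /ltr_add_invr[n]; rewrite add0r => /ltW hn; exists n.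
by rewrite -eE -[leLHS](_ : (n.+1%:R^-1 : R)%:C%C = _) ?lecR// fmorphV rmorph_nat.
Qed.

Lemma norm_zexp t : `|zexp t| = 1.
Proof. by rewrite norm_complex_quat -slice_exp_complex normq_slice_exp//; exact:
  imaginary_quat_i. Qed.

Lemma complex_quat_horner (p : {poly C}) t :
  complex_quat p.[zexp t] =
  \sum_(k < size p) slice_exp (quat_i : H) t ^+ k * complex_quat p`_k.
Proof.
rewrite horner_coef rmorph_sum; apply: eq_bigr => k _.
by rewrite mulrC rmorphM rmorphXn /= -slice_exp_complex.
Qed.

Lemma parseval_poly (p : {poly C}) :
  has_circle_integral (fun t => `|complex_quat p.[zexp t]| ^+ 2)
    (2 * pi * \sum_(k < size p) `|complex_quat p`_k| ^+ 2).
Proof.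
under eq_fun do rewrite complex_quat_horner.
exact: (parseval_slice (fun k => complex_quat p`_k) (size p) (@imaginary_quat_i R)).
Qed.

Lemma square_bounded_finite M N (u : nat -> H) :
  (forall k, (N <= k)%N -> u k = 0) ->
  \sum_(k < N) `|u k| ^+ 2 <= M -> square_bounded M u.
Proof.
move=> u0 uM n; apply: (le_trans _ uM).
rewrite [leRHS](big_ord_widen (maxn n N) (fun k => `|u k| ^+ 2)) ?leq_maxr//.
rewrite (big_ord_widen (maxn n N) (fun k => `|u k| ^+ 2) (leq_maxl n N)).
rewrite big_mkcond [leRHS]big_mkcond ler_sum// => k _.
case: ltnP => _; case: ltnP => [|Nk]; rewrite ?exprn_ge0//.
by rewrite u0// normr0 expr0n.
Qed.

(** On the circle |S|^2 <= |Q| + e = |P| + e <= g + 2e, and Parseval turns the mean of |S|^2 into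
    the l2 norm of the coefficients of [S]. *)
Lemma near_factorization_circle (P : {poly C}) (g : R -> R) N e M : 0 < e ->
  (forall t, 0 <= g t) -> (forall t, `|complex_quat P.[zexp t]| <= g t + e) ->
  (\int[mu]_(t in circle) (g t)%:E <= (2 * pi * M)%:E)%E ->
  exists s t : nat -> H,
    [/\ square_bounded (M + 2 * e) s, square_bounded (M + 2 * e) t &
        forall n, (n < N)%N -> `|complex_quat P`_n - cauchy_product s t n| <= e].
Proof.
move=> e0 g0 Pg gM.
have e0' : 0 < e%:C%C by rewrite ltcR.
have [Q [S [T [nQ SQ TS hTS]]]] := near_factorization archimedean_complex P N e0'.
have Sg t : `|complex_quat S.[zexp t]| ^+ 2 <= g t + 2 * e.
  have : `|S.[zexp t] ^+ 2| <= `|P.[zexp t]| + e%:C%C.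
    have -> : S.[zexp t] ^+ 2 = Q.[zexp t] + (S ^+ 2 - Q).[zexp t].
      by rewrite hornerD hornerN horner_exp addrC subrK.
    rewrite (le_trans (ler_normD _ _))// nQ ?norm_zexp// lerD2l.
    by rewrite (le_trans (norm_horner_le_l1norm _ _))// norm_zexp.
  rewrite normrX !norm_complex_quat -rmorphXn -rmorphD lecR => /le_trans -> //.
  by have := Pg t; lra.
have pi0 : 0 < 2 * pi :> R by rewrite mulr_gt0 ?pi_gt0.
have hS : \sum_(k < size S) `|complex_quat S`_k| ^+ 2 <= M + 2 * e.
  have := circle_integral_le_approx (parseval_poly S) (fun t => exprn_ge0 _
    (normr_ge0 _)) g0
    (ltW (mulr_gt0 _ e0)) Sg.
  move=> /(_ (ltr0Sn _ _))/le_trans => /(_ _ (leeD2r _ gM)).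
  by rewrite -EFinD lee_fin -mulrDr ler_pM2l.
have sS : square_bounded (M + 2 * e) (fun k => complex_quat S`_k).
  by apply: square_bounded_finite hS => k Sk; rewrite nth_default// rmorph0.
(* [T] is cut at [N] because only its first [N] coefficients are controlled; Cauchy coefficients
   below [N] do not see the cut. *)
exists (fun k => if (k < N)%N then complex_quat T`_k else 0), (fun k =>
  complex_quat S`_k).
split => //.
  apply: (@square_bounded_finite _ N) => [k|].
    by rewrite leqNgt => /negPf ->.
  apply: (le_trans _ (sS N)); rewrite -lecR !rmorph_sum/=.
  apply: le_trans (le_trans _ TS) _; rewrite le_eqVlt; apply/orP; left; apply/eqP;
    by apply: eq_bigr => k _; rewrite ?ltn_ord norm_complex_quat rmorphXn.
move=> n nN; rewrite -lecR.
have -> : cauchy_product (fun k => if (k < N)%N then complex_quat T`_k else 0)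
    (fun k => complex_quat S`_k) n = complex_quat (T * S)`_n.
  rewrite coefM rmorph_sum; apply: eq_bigr => k _ /=.
  by rewrite rmorphM (leq_ltn_trans _ nN)// -ltnS.
by rewrite -rmorphB -norm_complex_quat distrC; exact: hTS.
Qed.

End Factorization.

(** * Factorization of functions in the Hardy space H^1 *)

Section Hardy1Factorization.
Context {R : realType}.
Notation H := (quat R).
Notation C := (R[i]).
Notation mu := (@lebesgue_measure R).
Notation circle := (`[(- pi)%R, (pi : R)]%classic : set R).
Notation zexp t := (Complex (cos t) (sin t) : C).
Notation quat_i := (quat_i : H).

Lemma scale_slice_exp_complex (r t : R) :
  r *: slice_exp quat_i t = complex_quat (r%:C%C * zexp t).
Proof. by apply/quat_eqP; split => /=; ring. Qed.

Lemma complex_quat_power_sum (p : nat -> C) (r t : R) N :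
  \sum_(k < N) (r *: slice_exp quat_i t) ^+ k * complex_quat (p k) =
  complex_quat (\poly_(k < N) (r%:C%C ^+ k * p k)).[zexp t].
Proof.
rewrite horner_poly rmorph_sum; apply: eq_bigr => k _.
rewrite scale_slice_exp_complex -rmorphXn -rmorphM; congr complex_quat.
by rewrite exprMn; ring.
Qed.

Lemma cvg_radius : (1 - harmonic j / 2 : R) @[j --> \oo] --> (1 : R).
Proof.
have h : (harmonic j / 2 : R) @[j --> \oo] --> (0 * 2^-1 : R).
  by apply: (@cvgM R); [exact: cvg_harmonic|exact: cvg_cst].
have : (1 - harmonic j / 2 : R) @[j --> \oo] --> (1 - 0 * 2^-1 : R).
  by apply: cvgB; [exact: cvg_cst|exact: h].
by rewrite mul0r subr0.
Qed.

(** [p] holds the coefficients of one complex component, dominated by [f] on circles. Its dilation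
    by r_j is factored up to degree [j] with error 1/(j+1), and compactness yields the limit as r_j
    tends to 1. *)
Lemma component_factorization (f : H -> H) (p : nat -> C) (M : R) :
  (forall r, 0 < r < 1 ->
    (\int[mu]_(t in circle) (`|f (r *: slice_exp quat_i t)|)%:E <= (2 * pi *
      M)%:E)%E) ->
  (forall r e, 0 < r < 1 -> 0 < e -> exists N0, forall N t, (N0 <= N)%N ->
    `|\sum_(k < N) (r *: slice_exp quat_i t) ^+ k * complex_quat (p k)|
      <= `|f (r *: slice_exp quat_i t)| + e) ->
  exists a b : nat -> H, [/\ square_bounded (M + 2) a, square_bounded (M + 2) b &
    forall n, complex_quat (p n) = cauchy_product a b n].
Proof.
move=> fM fp; pose r j : R := 1 - harmonic j / 2.
have h0 j : 0 < harmonic j :> R by rewrite /harmonic /= invr_gt0.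
have h1 j : harmonic j <= 1 :> R by rewrite /harmonic /= invf_le1 ?ltr0Sn// ler1n.
have r01 j : 0 < r j < 1 by rewrite /r; have := h0 j; have := h1 j; lra.
have step j : exists st : (nat -> H) * (nat -> H),
    [/\ square_bounded (M + 2) st.1, square_bounded (M + 2) st.2 &
    forall n, (n <= j)%N ->
      `|r j ^+ n *: complex_quat (p n) - cauchy_product st.1 st.2 n| <= harmonic j].
  (* [N] is at least [N0] for the bound by [f], and at least j + 1 so that truncation keeps the
     coefficients up to degree [j]. *)
  have [N0 hN] := fp _ _ (r01 j) (h0 j); pose N := maxn N0 j.+1.
  pose P := \poly_(k < N) ((r j)%:C%C ^+ k * p k).
  have Pg t : `|complex_quat P.[zexp t]| <= `|f (r j *: slice_exp quat_i t)| +
    harmonic j.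
    by rewrite -complex_quat_power_sum; exact: hN (leq_maxl _ _).
  have [s [t [hs ht hst]]] := near_factorization_circle j.+1 (h0 j)
    (fun t => normr_ge0 _) Pg (fM _ (r01 j)).
  have weak u : square_bounded (M + 2 * harmonic j) u -> square_bounded (M + 2) u.
    by move=> hu n; apply: le_trans (hu n) _; have := h1 j; lra.
  exists (s, t); split; [exact: weak|exact: weak|move=> n nj].
  have := hst n nj; rewrite coef_poly (leq_trans _ (leq_maxr _ _))//.
  congr (`|_ - _| <= _); rewrite -rmorphXn.
  by apply/quat_eqP; case: (p n) => x y; split => /=; ring.
have /choice[st hst] := step.
apply: (@cauchy_product_compact _ (fun j => (st j).1) (fun j => (st j).2)).
- by move=> j; have [] := hst j.
- by move=> j; have [] := hst j.
move=> n; apply/cvgrPdist_le => e e0; have e2 : 0 < e / 2 by rewrite divr_gt0.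
have cr : r j ^+ n *: complex_quat (p n) @[j --> \oo] --> complex_quat (p n).
  rewrite -[X in _ --> X]scale1r -(expr1n R n).
  apply: cvgZ; last exact: cvg_cst.
  by apply: (@cvg_comp _ _ _ r (fun x : R => x ^+ n) _ _ _ cvg_radius); exact:
    exprn_continuous.
have /cvgrPdist_le/(_ _ e2) cr2 := cr.
have /cvgr0_norm_le/(_ _ e2) ch := @cvg_harmonic R.
near=> j.
have -> : complex_quat (p n) - cauchy_product (st j).1 (st j).2 n =
   (complex_quat (p n) - r j ^+ n *: complex_quat (p n)) +
   (r j ^+ n *: complex_quat (p n) - cauchy_product (st j).1 (st j).2 n).
  by rewrite addrA subrK.
rewrite (le_trans (ler_normD _ _))// [leRHS](splitr e) lerD//.
  by near: j.
have [_ _ /(_ n) hn] := hst j.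
apply: le_trans (hn _) _; first by near: j; exact: nbhs_infty_ge.
by rewrite (le_trans (ler_norm _))//; near: j.
Unshelve. all: by end_near. Qed.

Lemma hardy1_circle_bound (f : H -> H) : hardy1 f -> exists M : R, forall r, 0 <
  r < 1 ->
  (\int[mu]_(t in circle) (`|f (r *: slice_exp quat_i t)|)%:E <= (2 * pi * M)%:E)%E.
Proof.
move=> [_]; set S := ereal_sup _ => Sfin.
have pi0 : 0 < 2 * pi :> R by rewrite mulr_gt0 ?pi_gt0.
have mean_le r : 0 < r < 1 -> (circle_mean f quat_i r <= S)%E.
  move=> r01; apply: le_trans (ereal_sup_ubound (_ : _ _)); last first.
    by exists quat_i => //; exact: imaginary_quat_i.
  by apply: ereal_sup_ubound; exists r => //=; rewrite in_itv.
have S0 : (0 <= S)%E.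
  apply: le_trans (mean_le 2^-1 _); last by lra.
  rewrite mule_ge0 ?lee_fin ?invr_ge0 ?(ltW pi0)//.
  by apply: integral_ge0 => t _; rewrite lee_fin.
exists (fine S) => r /mean_le; rewrite EFinM fineK ?ge0_fin_numE//.
by rewrite /circle_mean lee_pdivrMl.
Qed.

Lemma hardy1_factorization (f : H -> H) : hardy1 f ->
  exists f1 g1 f2 g2 : H -> H,
    [/\ hardy2 f1, hardy2 g1, hardy2 f2, hardy2 g2 &
        forall q : H, unit_ball q -> f q = star f1 g1 q + star f2 g2 q].
Proof.
move=> hf; have [M hM] := hardy1_circle_bound hf.
have ea := expansion_coefs (proj1 hf); set a := coefs f in ea.
pose al n : C := Complex (qre (a n)) (qi (a n)).
pose be n : C := Complex (qj (a n)) (qk (a n)).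
have aE n : a n = complex_quat (al n) + complex_quat (be n) * quat_j.
  by apply/quat_eqP; split => /=; ring.
have sumE r t N : \sum_(k < N) (r *: slice_exp quat_i t) ^+ k * a k =
    \sum_(k < N) (r *: slice_exp quat_i t) ^+ k * complex_quat (al k) +
    (\sum_(k < N) (r *: slice_exp quat_i t) ^+ k * complex_quat (be k)) * quat_j.
  rewrite mulr_suml -big_split; apply: eq_bigr => k _ /=.
  by rewrite aE mulrDr mulrA.
(* The summands of C + C j are orthogonal, so each component is dominated by the whole and inherits
   the bound from [f]. *)
have comp_le (x y : C) : `|complex_quat x| <= `|complex_quat x + complex_quat y
  * quat_j| /\
    `|complex_quat y| <= `|complex_quat x + complex_quat y * quat_j|.
  by split; rewrite -(@ler_pXn2r _ 2) ?nnegrE// normq_complex_decomp ?lerDl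
    ?lerDr exprn_ge0.
have unif r e : 0 < r < 1 -> 0 < e -> exists N0, forall N t, (N0 <= N)%N ->
    `|\sum_(k < N) (r *: slice_exp quat_i t) ^+ k * a k|
      <= `|f (r *: slice_exp quat_i t)| + e.
  move=> /andP[r0 r1] e0; have r01 : 0 <= r < 1 by rewrite ltW.
  have [N0 hN] := expansion_unif r01 e0 ea; exists N0 => N t NN.
  have nr : `|r *: slice_exp quat_i t| = r.
    by rewrite norm_scale_slice_exp ?ltW//; exact: imaginary_quat_i.
  have := hN N _ NN nr; rewrite distrC => h.
  by rewrite -lerBlDl (le_trans (lerB_dist _ _)).
have [||a1 [b1 [ha1 hb1 e1]]] := component_factorization (f := f) (p := al) (M
  := M).
- exact: hM.
- move=> r e r01 e0; have [N0 hN] := unif r e r01 e0; exists N0 => N t NN.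
  apply: le_trans (hN N t NN); rewrite sumE !complex_quat_power_sum.
  exact: (comp_le _ _).1.
have [||a2 [b2 [ha2 hb2 e2]]] := component_factorization (f := f) (p := be) (M
  := M).
- exact: hM.
- move=> r e r01 e0; have [N0 hN] := unif r e r01 e0; exists N0 => N t NN.
  apply: le_trans (hN N t NN); rewrite sumE !complex_quat_power_sum.
  exact: (comp_le _ _).2.
(* The [quat_j] to the right of the second component is absorbed by the right factor, whose
   coefficient norms do not change. *)
pose b2j n := b2 n * quat_j.
have hb2j : square_bounded (M + 2) b2j.
  apply: square_bounded_le hb2 => n; rewrite normqM.
  have -> : `|quat_j : H| = 1.
    apply: (@pexpIrn _ 2) => //; rewrite ?nnegrE// normq_sqr /quat_dot /=; ring.
  by rewrite mulr1.
have [hf1 c1] := hardy2_power_series ha1; have [hg1 d1] := hardy2_power_series hb1.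
have [hf2 c2] := hardy2_power_series ha2; have [hg2 d2] := hardy2_power_series hb2j.
exists (power_series a1), (power_series b1), (power_series a2), (power_series b2j).
split => // q qb.
rewrite /star c1 d1 c2 d2.
have s1 := cvg_power_series (fun n => cauchy_product_le n ha1 hb1) qb.
have s2 := cvg_power_series (fun n => cauchy_product_le n ha2 hb2j) qb.
apply: (cvg_unique (@norm_hausdorff _ _) (ea q qb)).
have -> : series (fun n => q ^+ n * a n) =
    series (fun n => q ^+ n * cauchy_product a1 b1 n) +
    series (fun n => q ^+ n * cauchy_product a2 b2j n).
  apply/funext => n; rewrite /series /= fctE /= -big_split; apply: eq_bigr => k
    _ /=.
  rewrite -mulrDr aE e1 e2 /cauchy_product mulr_suml; congr (_ * (_ + _)).
  by apply: eq_bigr => m _; rewrite mulrA.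
exact: cvgD s1 s2.
Qed.

End Hardy1Factorization.

Theorem proposition5p5 (R : realType) (f : quat R -> quat R) :
  hardy1 f <->
  exists f1 g1 f2 g2 : quat R -> quat R,
    [/\ hardy2 f1, hardy2 g1, hardy2 f2, hardy2 g2 &
        forall q : quat R, unit_ball q -> f q = star f1 g1 q + star f2 g2 q].
Proof.
split; first exact: hardy1_factorization.
move=> [f1 [g1 [f2 [g2 [hf1 hg1 hf2 hg2 fE]]]]].
exact: star_sum_hardy1 hf1 hg1 hf2 hg2 fE.
Qed.
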